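(* Let $p\geq 14000$ be a prime and let $A\subseteq\mathbb{Z}/p\mathbb{Z}$ be sum-free with $|A|\geq 0.313\,p$. Then there exists $m\in[1,p-1]$ such that $m\cdot A\subseteq [\,|A|,\,p-|A|\,]$, where $\mathbb{Z}/p\mathbb{Z}$ is identified with the integers $\{0,1,\dots,p-1\}$.
   Context: A set $A\subseteq\mathbb{Z}/p\mathbb{Z}$ is sum-free if there are no $x,y,z\in A$ with $x+y=z$. For an integer $m$, $m\cdot A=\{mx:x\in A\}$. The interval $[\,|A|,p-|A|\,]$ denotes the set of residues of the integers $|A|,|A|+1,\dots,p-|A|$. *)

(* Defs.v *)
From mathcomp Require Import all_boot.
Set Implicit Arguments. Unset Strict Implicit. Unset Printing Implicit Defensive.

Definition sum_free (p : nat) (A : {set 'I_p}) : Prop :=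
  forall x y z : 'I_p, x \in A -> y \in A -> z \in A -> (x + y) %% p <> z.

(* Main.v *)
(* Write n = |A|.  Since A is disjoint from A - A, some nontrivial Fourier coefficient of A has real
   part at most - n ^ 2 / (p - n).  If every half-arc of the corresponding dilate of A had at most
   k points, then the number of points in a half-arc, a function on the circle with increments in
   {-1, 0, 1} and values in [n - k, k], would bound that coefficient, and for n >= 0.313 p this bound
   is violated unless 3 k >= p - n + 4.  So some half-arc of a dilate of A contains a set A' of points
   with |A' - A'| <= p - n <= 3 |A'| - 4, because A' - A' avoids that dilate.  In the half-arc, A' can
   be treated as a set of integers.  The 3k - 4 theorem for difference sets, in the form that
   A' - A' contains all d * x with |x| < |A'|, where d is the gcd of A' - A', then produces a dilate of
   A that avoids (-|A'|, |A'|).  This puts more points of A into one half-arc; after two more rounds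
   A' is all of A. *)

Require Import Defs.
From Stdlib Require Import Reals Lra.
From mathcomp Require Import all_boot all_order all_fingroup all_algebra.
From mathcomp Require Import Rstruct.
From mathcomp Require Import zify ring lra.
Set Implicit Arguments. Unset Strict Implicit. Unset Printing Implicit Defensive.
Import Order.TTheory GRing.Theory Num.Theory.

(** * Kneser's theorem *)

(** The usual 3k - 4 theorem bounds the number of differences, but the dilation step needs every d *
    x with |x| < |A'| to be a difference. The integer statement therefore starts from a missing x
    and shows that there are then too many differences. For k integers in [0, L] including 0 and L,
    two arguments are needed: if 2 k > L + 2, counting points near both ends is enough; otherwise
    the set is reduced modulo L. There the difference set may be a union of cosets of a nontrivial
    subgroup, and Kneser's theorem controls this. In the Fourier step the range of the half-arc
    count alone does not suffice: it allows a coefficient of size 0.1452 p, while sum-freeness is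
    only used to force 0.1425 p. Since its steps have size at most 1, the count cannot jump between
    its extremes, and this saves a cubic term larger than the discrepancy. *)

Ltac card_lia :=
  repeat match goal with |- context [card ?X] => generalize (card X); intro end;
  repeat match goal with H : ?T |- _ => lazymatch T with nat => fail | _ => clear H end end;
  lia.

Section Kneser.
Local Open Scope group_scope.
Variable gT : finGroupType.
Hypothesis cGG : abelian [set: gT].

Lemma abelian_mulgC (x y : gT) : x * y = y * x.
Proof. by apply: (centsP cGG); rewrite inE. Qed.

Lemma abelian_mulsC (A B : {set gT}) : A * B = B * A.
Proof. by apply: centC; apply: subset_trans (subsetT _) (subset_trans cGG (centS (subsetT _))). Qed.

Definition stab (C : {set gT}) := [set x | C :* x == C].
Lemma group_set_stab C : group_set (stab C).
Proof.
apply/group_setP; split=> [|x y]; rewrite ?inE ?rcoset1 // => /eqP hx /eqP hy.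
by rewrite rcosetM hx hy.
Qed.
Canonical stab_group C := Group (group_set_stab C).

Lemma sub_stabP (C : {set gT}) (K : {group gT}) : reflect (C * K = C) (K \subset stab C).
Proof.
apply: (iffP idP) => [sK|h].
  apply/eqP; rewrite eqEsubset mulG_subl andbT; apply/subsetP=> _ /mulsgP[x y xC yK ->].
  have := subsetP sK y yK; rewrite inE => /eqP <-.
  by rewrite mem_rcoset mulgK.
apply/subsetP=> y yK; rewrite inE eqEcard card_rcoset leqnn andbT.
by rewrite -{2}h; apply: mulgS; rewrite sub1set.
Qed.

Lemma mul_stab (C : {set gT}) : C * stab C = C.
Proof. exact/(sub_stabP C (stab_group C)). Qed.

Lemma leq_card_mul_subgroup (K Q : {group gT}) (D T : {set gT}) :
  Q \subset K -> T \subset D * K ->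
  #|D * Q| + #|T :\: D * Q| <= #|D * K|.
Proof.
move=> sQK sT; have sD : D * Q \subset D * K by apply: mulgS.
have -> : #|D * K| = #|D * Q| + #|(D * K) :\: D * Q|.
  by rewrite cardsD (setIidPr sD) subnKC // subset_leq_card.
by rewrite leq_add2l; apply: subset_leq_card; apply: setSD.
Qed.

Lemma mem_mulsg (A B : {set gT}) x y : x \in A -> y \in B -> x * y \in A * B.
Proof. by move=> xA yB; apply/mulsgP; exists x y. Qed.

Lemma set0_mulg (B : {set gT}) : set0 * B = set0.
Proof. by apply/setP=> x; rewrite inE; apply/negP=> /mulsgP[y z]; rewrite inE. Qed.

Lemma lcoset_eq_sym (K : {group gT}) x y : reflect (x *: K = y *: K) (y \in x *: K).
Proof. by apply: (iffP lcoset_eqP) => ->. Qed.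

(* DeVos' proof of Kneser's theorem.  Take a convergent C with K minimal.  If K does not stabilise
   A * B, then some coset of K meets A * B properly, and adding to C the parts of A * B that
   come from two cosets of K gives a convergent with a smaller subgroup. *)
Definition convergent (A B : {set gT}) (K : {group gT}) (C : {set gT}) :=
  [&& C \subset A * B, C * K == C &
      #|A :&: B| + #|(A :|: B) * K| <= #|C| + #|K|].

Section Step.
Variables (A B C : {set gT}) (K : {group gT}).
Hypothesis cvg : convergent A B K C.
Hypothesis minK : forall (Q : {group gT}) C', convergent A B Q C' -> #|K| <= #|Q|.
Hypothesis C0 : C != set0.
Hypothesis IH : forall A' B' : {set gT}, A' != set0 -> B' != set0 ->
  #|A' * B'| < #|A * B| ->
  exists Q : {group gT}, A' * B' * Q = A' * B' /\ #|A' * Q| + #|B' * Q| <= #|A' * B'| + #|Q|.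

(** By minimality of [K], the set [C :|: D] cannot be convergent with the smaller subgroup [Q], so
    its inequality fails. Passing from [K] to [Q] removes from [(A :|: B) * K] at least the part of
    [T] outside [(A :|: B) * Q]. *)
Lemma convergent_gap (Q : {group gT}) (D T : {set gT}) :
  Q \proper K -> D \subset A * B -> D * Q = D -> [disjoint C & D] ->
  T \subset (A :|: B) * K ->
  #|T :\: (A :|: B) * Q| + #|D| + #|Q| < #|K|.
Proof.
move=> prQ sD DQ dis sT.
have /and3P[sCAB /eqP CK cK] := cvg.
have sQK := proper_sub prQ.
rewrite ltnNge; apply/negP => big.
suff /minK : convergent A B Q (C :|: D).
  by rewrite leqNgt => /negP; apply; apply: proper_card.
apply/and3P; split; first by rewrite subUset sCAB.
  rewrite mulUg DQ; apply/eqP; congr (_ :|: _); apply/eqP.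
  by rewrite eqEsubset mulG_subl andbT -{2}CK mulgS.
have := leq_card_mul_subgroup sQK sT.
have -> : #|C :|: D| = #|C| + #|D| by apply/eqP; rewrite (leq_card_setU C D).2.
by lia.
Qed.

(** [A1 * B1] misses [C], so the induction hypothesis applies to [A1] and [B1] and bounds
    [#|A1 * Q| + #|B1 * Q|]. By [convergent_gap], [(A :|: B) * Q] covers much of the two cosets, and
    what [A1] and [B1] cannot cover is left to the crossed parts [A2] and [B2]. *)
Lemma convergent_half a b : a \in A -> b \in B -> ~~ (((a * b)%g *: K) \subset A * B) ->
  exists Q : {group gT}, [/\ Q \proper K,
    (A :&: a *: K) * (B :&: b *: K) * Q = (A :&: a *: K) * (B :&: b *: K) &
    #|K| < #|(A :&: b *: K) * Q| + #|(B :&: a *: K) * Q|].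
Proof.
move=> aA bB nsub.
have [sCAB /eqP CK cK] := and3P cvg.
set A1 := A :&: a *: K; set B1 := B :&: b *: K.
set A2 := A :&: b *: K; set B2 := B :&: a *: K.
have aA1 : a \in A1 by rewrite inE aA lcoset_refl.
have bB1 : b \in B1 by rewrite inE bB lcoset_refl.
have sAB : A1 * B1 \subset A * B by apply: mulgSS; apply: subsetIl.
have sK : A1 * B1 \subset (a * b)%g *: K.
  apply/subsetP=> w /mulsgP[x y /setIP[_ /lcosetP[u uK ->]] /setIP[_ /lcosetP[v vK ->]] ->].
  have -> : a * u * (b * v) = a * b * (u * v) by rewrite !mulgA -(mulgA a) (abelian_mulgC u) mulgA.
  by rewrite mem_lcoset mulKg groupM.
have dis : [disjoint C & A1 * B1].
  apply/pred0P=> x /=; apply/negP=> /andP[xC /(subsetP sK) xK].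
  case/negP: nsub; apply: subset_trans sCAB.
  have /lcoset_eq_sym -> := xK.
  by rewrite -CK; apply: mulSg; rewrite sub1set.
have [|||Q [A1B1Q cQ]] := IH (A' := A1) (B' := B1).
- by apply/set0Pn; exists a.
- by apply/set0Pn; exists b.
- apply: proper_card; rewrite properE sAB; apply/subsetPn.
  have /set0Pn[x xC] := C0; exists x; first exact: (subsetP sCAB).
  by rewrite (disjointFr dis xC).
have abAB : (a * b)%g \in A1 * B1 by rewrite mem_mulsg.
have sQK : Q \subset K.
  apply/subsetP=> u uQ; have := subsetP sK (a * b * u)%g.
  by rewrite -A1B1Q mem_mulsg // mem_lcoset mulKg => ->.
have prQ : Q \proper K.
  rewrite properE sQK; apply: contra nsub => sKQ; apply: subset_trans sAB.
  by rewrite -A1B1Q; apply: mulgSS => //; rewrite sub1set.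
exists Q; split=> //.
set T := a *: K :|: b *: K.
have sT : T \subset (A :|: B) * K.
  by rewrite subUset; apply/andP; split; apply: mulSg; rewrite sub1set inE ?aA ?bB ?orbT.
pose D := (A :|: B) * Q.
have gap : #|T :\: D| + #|A1 * B1| + #|Q| < #|K| := convergent_gap prQ sAB A1B1Q dis sT.
have inT : T :&: D \subset (A1 * Q :|: B1 * Q) :|: (A2 * Q :|: B2 * Q).
  apply/subsetP=> x /setIP[xT /mulsgP[y u yAB uQ xE]].
  have uK := subsetP sQK u uQ.
  have yT : y \in T.
    move: xT; rewrite xE !inE !mem_lcoset !mulgA.
    by rewrite !(groupMr _ uK).
  have hy (S : {set gT}) : y \in S -> x \in S * Q by move=> yS; rewrite xE mem_mulsg.
  move: yT yAB; rewrite !inE => /orP[] yT /orP[] yAB.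
  - by rewrite hy // inE yAB.
  - by rewrite (hy B2) ?orbT // inE yAB.
  - by rewrite (hy A2) ?orbT // inE yAB.
  - by rewrite (hy B1) ?orbT // inE yAB.
move: gap (subset_leq_card inT).
have : #|T :&: D| + #|T :\: D| = #|T| by exact: cardsID.
(* If the cosets coincide, the crossed parts are [A1] and [B1] themselves, and the gap contradicts
   the inductive bound. *)
have [eqK|neK] := eqVneq (a *: K) (b *: K).
  have -> : B2 = B1 by rewrite /B2 eqK.
  have -> : A2 = A1 by rewrite /A2 -eqK.
  have -> : #|T| = #|K| by rewrite /T -eqK setUid card_lcoset.
  move: (leq_card_setU (A1 * Q) (B1 * Q)) => [+ _]; rewrite setUid; move: cQ; card_lia.
have -> : #|T| = #|K| + #|K|.
  rewrite /T -{1}(card_lcoset K a) -(card_lcoset K b); apply/eqP.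
  rewrite (leq_card_setU _ _).2; apply/pred0P=> x /=; apply/negP=> /andP[xa xb].
  by case/eqP: neK; rewrite (lcoset_eq_sym _ _ _ xa) (lcoset_eq_sym _ _ _ xb).
move: (leq_card_setU (A1 * Q) (B1 * Q)) (leq_card_setU (A2 * Q) (B2 * Q)).
move: (leq_card_setU (A1 * Q :|: B1 * Q) (A2 * Q :|: B2 * Q)) => [+ _] [+ _] [+ _].
move: cQ; card_lia.
Qed.

(* Translating by x maps the part of the coset of a * b that is missed by A1 * B1 and A2 * B2
   into the part of a *: K that is missed by (A :|: B) * (K1 :&: K2). *)
Lemma convergent_no_meet (K1 K2 : {group gT}) (a b x : gT) (A1 A2 B1 B2 : {set gT}) :
  A1 = A :&: a *: K -> B2 = B :&: a *: K ->
  A2 :|: B1 \subset b *: K ->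
  K1 \proper K -> K2 \proper K ->
  A1 * B1 * K1 = A1 * B1 -> A2 * B2 * K2 = A2 * B2 ->
  A1 * B1 \subset A * B -> A2 * B2 \subset A * B ->
  a \in A :|: B -> ~~ (((a * b)%g *: K) \subset A * B) ->
  x \in b *: K -> x \in B1 * K1 -> x \in A2 * K2 -> False.
Proof.
move=> eA1 eB2 sb pr1 pr2 st1 st2 s1 s2 aAB nsub xb xB1 xA2.
have /and3P[sCAB /eqP CK cK] := cvg.
pose J := (K1 :&: K2)%G; pose D := A1 * B1 :|: A2 * B2.
have abC z : z \in (a * b)%g *: K -> z \notin C.
  move=> zab; apply: contra nsub => zC; apply: subset_trans sCAB.
  by have /lcoset_eq_sym -> := zab; rewrite -CK; apply: mulSg; rewrite sub1set.
have abE y z : y \in a *: K -> z \in b *: K -> y * z \in (a * b)%g *: K.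
  move=> /lcosetP[u uK ->] /lcosetP[v vK ->].
  have -> : a * u * (b * v) = a * b * (u * v) by rewrite !mulgA -(mulgA a) (abelian_mulgC u) mulgA.
  by rewrite mem_lcoset mulKg groupM.
have sDab : D \subset (a * b)%g *: K.
  rewrite subUset; apply/andP; split; apply/subsetP=> w /mulsgP[y z yA zB ->].
    apply: abE; first by move: yA; rewrite eA1 => /setIP[].
    by apply: (subsetP sb); rewrite inE zB orbT.
  rewrite (abelian_mulgC y); apply: abE; first by move: zB; rewrite eB2 => /setIP[].
  by apply: (subsetP sb); rewrite inE yA.
have prJ : J \proper K by apply: sub_proper_trans pr1; apply: subsetIl.
have sDAB : D \subset A * B by rewrite subUset s1.
have DJ : D * J = D.
  apply/sub_stabP; apply/subsetP=> u /setIP[u1 u2]; rewrite inE eqEcard card_rcoset leqnn andbT.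
  apply/subsetP=> w; rewrite mem_rcoset => /setUP[] wD; apply/setUP; [left|right].
    by rewrite -st1 -(mulgKV u w) mem_mulsg.
  by rewrite -st2 -(mulgKV u w) mem_mulsg.
have dis : [disjoint C & D].
  apply/pred0P=> w /=; apply/negP=> /andP[wC /(subsetP sDab)/abC].
  by rewrite wC.
have sT : a *: K \subset (A :|: B) * K by apply: mulSg; rewrite sub1set.
have gap : #|a *: K :\: (A :|: B) * J| + #|D| + #|J| < #|K| := convergent_gap prJ sDAB DJ dis sT.
pose S := ((a * b)%g *: K) :\: D.
have cS : #|S| + #|D| = #|K|.
  by rewrite /S cardsD (setIidPr sDab) card_lcoset subnK // -(card_lcoset K (a * b)) subset_leq_card.
have : #|S| <= #|a *: K :\: (A :|: B) * J|.
  rewrite -(card_rcoset S x^-1); apply: subset_leq_card.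
  apply/subsetP=> y; rewrite mem_rcoset invgK => /setDP[yab yD].
  have ya : y \in a *: K.
    move: yab xb => /lcosetP[u uK yx] /lcosetP[v vK xE].
    rewrite mem_lcoset.
    suff -> : a^-1 * y = u * v^-1 by rewrite groupM ?groupV.
    have -> : y = a * b * u * x^-1 by rewrite -yx mulgK.
    by rewrite xE invMg (abelian_mulgC v^-1) -!mulgA mulKg !mulgA (abelian_mulgC b u) mulgK.
  rewrite !inE ya andbT; apply: contra yD => /mulsgP[z j zAB /setIP[j1 j2] yE].
  have jK : j \in K by apply: (subsetP (proper_sub prJ)); rewrite inE j1.
  have za : z \in a *: K.
    by move: ya; rewrite yE !mem_lcoset mulgA (groupMr _ jK).
  have eqS : y * x = z * (x * j) by rewrite yE -mulgA (abelian_mulgC j).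
  rewrite eqS; case/setUP: zAB => zAB; apply/setUP; [left|right].
    rewrite -st1 -mulgA mem_mulsg //; first by rewrite eA1 inE zAB.
    have /mulsgP[y1 k1 y1B k1K ->] := xB1.
    by rewrite -mulgA mem_mulsg // groupM.
  rewrite (abelian_mulsC A2) in st2 *.
  rewrite -st2 -mulgA mem_mulsg //; first by rewrite eB2 inE zAB.
  have /mulsgP[y1 k1 y1B k1K ->] := xA2.
  by rewrite -mulgA mem_mulsg // groupM.
move: (cardG_gt0 J) cS gap; card_lia.
Qed.

(** [convergent_half] for [(a, b)] forces [A2] and [B2] to be nonempty, since one part alone covers
    at most a coset; so it also applies to a pair taken from them. The two bounds add up to more
    than [2 * #|K|]. Hence over [M = K1 * K2] either [B1] and [A2] or [A1] and [B2] overlap in a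
    coset of [K], against [convergent_no_meet]. *)
Lemma convergent_stable : A * B * K = A * B.
Proof.
apply/eqP; rewrite eqEsubset mulG_subl andbT; apply/negP=> /negP/subsetPn[w].
case/mulsgP=> _ u /mulsgP[a b aA bB ->] uK -> nAB.
have nsub : ~~ (((a * b)%g *: K) \subset A * B).
  by apply/subsetPn; exists (a * b * u)%g => //; rewrite mem_lcoset mulKg.
have [K1 [pr1 st1 big1]] := convergent_half aA bB nsub.
set A1 := A :&: a *: K in st1; set B1 := B :&: b *: K in st1.
set A2 := A :&: b *: K in big1; set B2 := B :&: a *: K in big1.
have leK (S : {set gT}) (Q : {group gT}) c : S \subset c *: K -> Q \subset K -> #|S * Q| <= #|K|.
  move=> sS sQ; rewrite -(card_lcoset K c); apply: subset_leq_card.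
  rewrite -(mulGid K) mulgA; exact: mulgSS.
have sA2 : A2 \subset b *: K by apply: subsetIr.
have sB2 : B2 \subset a *: K by apply: subsetIr.
have sA1 : A1 \subset a *: K by apply: subsetIr.
have sB1 : B1 \subset b *: K by apply: subsetIr.
have /set0Pn[y yA2] : A2 != set0.
  apply: contraL big1 => /eqP ->.
  by rewrite set0_mulg cards0 add0n -leqNgt (leK _ _ a sB2) ?proper_sub.
have /set0Pn[x xB2] : B2 != set0.
  apply: contraL big1 => /eqP ->.
  by rewrite set0_mulg cards0 addn0 -leqNgt (leK _ _ b sA2) ?proper_sub.
have [yA yb] := setIP yA2; have [xB xa] := setIP xB2.
have eb : b *: K = y *: K by apply/lcoset_eq_sym.
have ea : a *: K = x *: K by apply/lcoset_eq_sym.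
have nsub2 : ~~ (((y * x)%g *: K) \subset A * B).
  suff <- : (a * b)%g *: K = (y * x)%g *: K by [].
  apply/lcoset_eq_sym; move: yb xa => /lcosetP[v vK ->] /lcosetP[v' v'K ->].
  have -> : b * v * (a * v') = a * b * (v * v').
    by rewrite (abelian_mulgC b v) -!mulgA (abelian_mulgC v) !mulgA (abelian_mulgC b a) -!mulgA (abelian_mulgC v).
  by rewrite mem_lcoset mulKg groupM.
have [K2 [pr2 st2 big2]] := convergent_half yA xB nsub2.
rewrite -eb -ea -/A1 -/B1 -/A2 -/B2 in st2 big2.
have s1 : A1 * B1 \subset A * B by apply: mulgSS; apply: subsetIl.
have s2 : A2 * B2 \subset A * B by apply: mulgSS; apply: subsetIl.
pose M := (K1 <*> K2)%G.
have M12 : M = K1 * K2 :> {set gT} by rewrite /M /= norm_joinEl // cents_norm // (subset_trans (subsetT _)) // (subset_trans cGG) // centS // subsetT.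
have sMK : M \subset K by rewrite join_subG !proper_sub.
have meet (S T : {set gT}) c : S \subset c *: K -> T \subset c *: K ->
    #|K| < #|S * M| + #|T * M| -> exists2 z, z \in c *: K & z \in S * K1 /\ z \in T * K2.
  move=> sS sT big.
  have sSM : S * M \subset c *: K by rewrite -(mulGid K) mulgA; apply: mulgSS.
  have sTM : T * M \subset c *: K by rewrite -(mulGid K) mulgA; apply: mulgSS.
  have /set0Pn[v /setIP[]] : (S * M) :&: (T * M) != set0.
    apply: contraL big => /eqP dis; rewrite -leqNgt -(card_lcoset K c).
    have := cardsUI (S * M) (T * M); rewrite dis cards0 addn0 => <-.
    by apply: subset_leq_card; rewrite subUset sSM.
  rewrite M12 !mulgA => /mulsgP[s1' k2 /mulsgP[s' k1 sS' k1K ->] k2K vE].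
  move=> /mulsgP[t1' k2' /mulsgP[t' k1' tT k1'K ->] k2'K]; rewrite vE => E.
  have Ez : s' * (k1 * k1'^-1) = t' * (k2' * k2^-1).
    have -> : s' * (k1 * k1'^-1) = s' * k1 * k2 * k2^-1 * k1'^-1 by rewrite mulgK mulgA.
    by rewrite E -!mulgA; congr (_ * _); rewrite (abelian_mulgC k1') -!mulgA mulVg mulg1.
  exists (s' * (k1 * k1'^-1)).
    apply: (subsetP sSM); rewrite M12 mem_mulsg // -[_ * _^-1]mulg1 mem_mulsg //.
    by rewrite groupM ?groupV.
  by split; [|rewrite Ez]; rewrite mem_mulsg // groupM ?groupV.
have leM (S : {set gT}) : #|S * K1| <= #|S * M| /\ #|S * K2| <= #|S * M|.
  by split; apply: subset_leq_card; apply: mulgS; rewrite ?joing_subl ?joing_subr.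
have [big|small] := ltnP #|K| (#|B1 * M| + #|A2 * M|).
  have [z zb [zB zA]] := meet B1 A2 b sB1 sA2 big.
  apply: (@convergent_no_meet K1 K2 a b z A1 A2 B1 B2) => //; last by rewrite inE aA.
  by rewrite subUset sA2.
have {}big : #|K| < #|A1 * M| + #|B2 * M|.
  move: (leM A1) (leM B1) (leM A2) (leM B2) big1 big2 small => [_ +] [_ +] [+ _] [+ _].
  card_lia.
have [z za [zA zB]] := meet A1 B2 a sA1 sB2 big.
apply: (@convergent_no_meet K2 K1 b a z A2 A1 B2 B1) => //; last by rewrite abelian_mulgC.
  by rewrite subUset sA1.
by rewrite inE bB orbT.
Qed.

End Step.

(** For the stabiliser [Q] of [A * B], the sets [A * Q] and [B * Q] have the same product; the [H]
    obtained for them stabilises it and so lies in [Q]. *)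
Lemma kneser_of_weak (A B : {set gT}) : A != set0 -> B != set0 ->
  (forall A' B' : {set gT}, A' != set0 -> B' != set0 -> A' * B' = A * B ->
     exists H : {group gT}, A' * B' * H = A' * B' /\ #|A'| + #|B'| <= #|A' * B'| + #|H|) ->
  exists H : {group gT}, A * B * H = A * B /\ #|A * H| + #|B * H| <= #|A * B| + #|H|.
Proof.
move=> A0 B0 weak; pose Q := stab_group (A * B).
have QE : A * Q * (B * Q) = A * B.
  by rewrite -mulgA (mulgA Q) (abelian_mulsC Q) -!mulgA mulGid !mulgA mul_stab.
have nz (S : {set gT}) : S != set0 -> S * Q != set0.
  by move=> /set0Pn[x xS]; apply/set0Pn; exists (x * 1); rewrite mem_mulsg // group1.
have [||//|H [HE cH]] := weak (A * Q) (B * Q); rewrite ?nz //.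
rewrite QE in HE cH.
exists Q; split; first exact: mul_stab.
apply: leq_trans cH _; rewrite leq_add2l subset_leq_card //.
by apply/sub_stabP.
Qed.

(** Induction on [#|A * B|], then on [#|A|]. If a translate [B1] of [B] meets [A] without containing
    it, the inner induction makes [(A :&: B1) * (A :|: B1)] a convergent, and a convergent with
    least subgroup stabilises [A * B1]. *)
Theorem kneser_weak (A B : {set gT}) : A != set0 -> B != set0 ->
  exists H : {group gT}, A * B * H = A * B /\ #|A| + #|B| <= #|A * B| + #|H|.
Proof.
have [n] := ubnP #|A * B|; elim: n A B => // n IHn A B.
have [m] := ubnP #|A|; elim: m A B => // m IHm A B ltA ltAB A0 B0.
have strong (A' B' : {set gT}) : A' != set0 -> B' != set0 -> #|A' * B'| < #|A * B| ->
    exists Q : {group gT}, A' * B' * Q = A' * B' /\ #|A' * Q| + #|B' * Q| <= #|A' * B'| + #|Q|.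
  move=> A'0 B'0 lt'; apply: kneser_of_weak => // A1 B1 A10 B10 eqAB.
  by apply: IHn => //; rewrite eqAB; apply: leq_trans lt' ltAB.
pose Q := <<A * A^-1>>%G.
(* If the quotients of elements of [A] stabilise [B], no such translate exists, but [A * B] is then
   a translate of [B]. *)
have [BQ|] := boolP (Q \subset stab B).
  have [a aA] := set0Pn _ A0.
  have sA : A \subset a *: Q.
    apply/subsetP=> x xA; rewrite mem_lcoset mem_gen // abelian_mulgC mem_mulsg //.
    by rewrite memV_invg.
  have BQE : B * Q = B by apply/sub_stabP.
  have ABE : A * B = a *: B.
    apply/eqP; rewrite eqEsubset andbC mulSg ?sub1set //=.
    by rewrite -{2}BQE (abelian_mulsC B) mulgA mulSg.
  exists Q; split; first by rewrite ABE -mulgA BQE.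
  by rewrite ABE card_lcoset addnC leq_add2l -(card_lcoset Q a) subset_leq_card.
rewrite gen_subG => /subsetPn[_ /mulsgP[a' a1 a'A aA ->]].
rewrite mem_invg in aA; set g := a' * a1.
rewrite inE eqEcard card_rcoset leqnn andbT => /subsetPn[c].
rewrite mem_rcoset; set b := c * g^-1 => bB cnB.
(* This translation sends [b] to [a1^-1], which is in [A], and sends [c], which is not in [B], to
   [a']. *)
pose B1 := B :* (b^-1 * a1^-1).
have AB1 : A * B1 = (A * B) :* (b^-1 * a1^-1) by rewrite mulgA.
have cAB1 : #|A * B1| = #|A * B| by rewrite AB1 card_rcoset.
have aB1 : a1^-1 \in B1 by rewrite mem_rcoset invMg !invgK mulgA mulVg mul1g.
have a'B1 : a' \notin B1.
  rewrite mem_rcoset invMg !invgK mulgA -/g abelian_mulgC.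
  by apply: contra cnB; rewrite /b mulgKV.
suff [H [HE cH]] : exists H : {group gT}, A * B1 * H = A * B1 /\ #|A| + #|B1| <= #|A * B1| + #|H|.
  exists H; split; last by rewrite -cAB1 -(card_rcoset B (b^-1 * a1^-1)).
  have E : (A * B * H) :* (b^-1 * a1^-1) = (A * B) :* (b^-1 * a1^-1).
    rewrite -AB1 -[RHS]HE AB1 -[LHS]mulgA -[RHS]mulgA; congr (_ * _); exact: abelian_mulsC.
  by rewrite -[LHS](rcosetK (b^-1 * a1^-1)) E rcosetK.
have B10 : B1 != set0 by apply/set0Pn; exists a1^-1.
have I0 : A :&: B1 != set0 by apply/set0Pn; exists a1^-1; rewrite inE aA.
have U0 : A :|: B1 != set0 by apply/set0Pn; exists a1^-1; rewrite inE aA.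
have ltI : #|A :&: B1| < #|A|.
  apply: proper_card; rewrite properE subsetIl; apply/subsetPn; exists a' => //.
  by rewrite inE negb_and a'B1 orbT.
pose C0 := (A :&: B1) * (A :|: B1).
have sC0 : C0 \subset A * B1.
  rewrite /C0 mulgU subUset (abelian_mulsC _ A); apply/andP; split; apply: mulgSS => //.
    exact: subsetIr.
  exact: subsetIl.
have cvg0 : convergent A B1 (stab_group C0) C0.
  pose K0 := stab_group C0.
  have CE : (A :&: B1) * ((A :|: B1) * K0) = C0 by rewrite mulgA; exact: mul_stab.
  have [||||H [HE cH]] := IHm (A :&: B1) ((A :|: B1) * K0); rewrite ?CE //.
  - exact: leq_trans ltI ltA.
  - by apply: leq_ltn_trans ltAB; rewrite -cAB1 subset_leq_card.
  - by have /set0Pn[x xU] := U0; apply/set0Pn; exists (x * 1); rewrite mem_mulsg // group1.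
  rewrite /convergent sC0 mul_stab eqxx /=; apply: leq_trans cH _; rewrite CE leq_add2l.
  by apply: subset_leq_card; apply/sub_stabP; rewrite -CE.
pose P (K : {group gT}) := [exists C, convergent A B1 K C].
have P0 : P (stab_group C0) by apply/existsP; exists C0.
have [K /existsP[C cvg] minK] := arg_minnP (fun K : {group gT} => #|K|) P0.
have Cn0 : C != set0.
  have /and3P[_ _ cK] := cvg; apply: contraL cK => /eqP ->; rewrite cards0 add0n -ltnNge.
  have /set0Pn[x xU] := U0.
  have : 0 < #|A :&: B1| by rewrite card_gt0.
  have : #|x *: K| <= #|(A :|: B1) * K| by apply: subset_leq_card; rewrite mulSg ?sub1set.
  by rewrite card_lcoset => le gt; rewrite -add1n; apply: leq_add.
exists K; split.
  apply: (@convergent_stable A B1 C K) => //.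
    by move=> Q' C' cQ; apply: minK; apply/existsP; exists C'.
  by rewrite cAB1; apply: strong.
have /and3P[sC _ cK] := cvg.
have sU : #|A :|: B1| <= #|(A :|: B1) * K|.
  by apply: subset_leq_card; rewrite -{1}[A :|: B1]mulg1 mulgS // sub1G.
have sC' : #|C| <= #|A * B1| := subset_leq_card sC.
have UI : #|A :|: B1| + #|A :&: B1| = #|A| + #|B1| := cardsUI A B1.
rewrite -UI addnC; apply: leq_trans (leq_add (leqnn _) sU) _.
by apply: leq_trans cK _; rewrite leq_add2r.
Qed.

Theorem kneser (A B : {set gT}) : A != set0 -> B != set0 ->
  exists H : {group gT}, A * B * H = A * B /\ #|A * H| + #|B * H| <= #|A * B| + #|H|.
Proof.
by move=> A0 B0; apply: kneser_of_weak => // A' B' A'0 B'0 _; apply: kneser_weak.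
Qed.

End Kneser.

(** * Difference sets of integers *)

Lemma sum_shift (f : nat -> nat) m n :
  \sum_(i < m + n) f i = \sum_(i < m) f i + \sum_(i < n) f (m + i).
Proof. by rewrite big_split_ord. Qed.

Lemma sum_rev (f : nat -> nat) n : \sum_(i < n.+1) f (n - i) = \sum_(i < n.+1) f i.
Proof.
rewrite [RHS](reindex_inj rev_ord_inj) /=.
by apply: eq_bigr => i _; rewrite subSS.
Qed.

Lemma sum_le1 (f : nat -> nat) n :
  (forall i, i < n -> f i <= 1) -> \sum_(i < n) f i <= n.
Proof.
move=> h; apply: leq_trans (_ : \sum_(i < n) 1 <= n); last by rewrite sum1_card card_ord.
by apply: leq_sum => i _; apply: h.
Qed.

Lemma sum_pred_card (P : pred nat) n : \sum_(i < n) P i = #|[set y : 'I_n | P y]|.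
Proof.
rewrite -sum1_card [RHS](eq_bigl (fun i : 'I_n => P i)); last by move=> i; rewrite inE.
by rewrite [RHS]big_mkcond; apply: eq_bigr => i _; case: (P i).
Qed.

Definition dif (e : pred nat) L y := [exists i : 'I_L.+1, [&& e i, i + y <= L & e (i + y)]].

Lemma dif_exP (e : pred nat) L y :
  reflect (exists i, [/\ e i, i + y <= L & e (i + y)]) (dif e L y).
Proof.
apply: (iffP existsP) => [[i /and3P[h1 h2 h3]]|[i [h1 h2 h3]]]; first by exists i.
have hi : i < L.+1 by lia.
by exists (Ordinal hi); rewrite /= h1 h2.
Qed.

Section Differences.
Variables (e : pred nat) (L k : nat).
Hypotheses (e0 : e 0) (eL : e L) (ek : \sum_(i < L.+1) e i = k).

Lemma dif_left w : w <= L -> e w -> dif e L w.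
Proof. by move=> wL ew; apply/dif_exP; exists 0. Qed.

Lemma dif_right w : w <= L -> e w -> dif e L (L - w).
Proof. by move=> wL ew; apply/dif_exP; exists w; rewrite subnKC. Qed.

Let F w := \sum_(i < w) (e i + e (L - i)).

Lemma ends_tail y : y <= L.+1 ->
  F y + \sum_(i < L.+1 - y) e i + \sum_(i < L.+1 - y) e (y + i) = 2 * k.
Proof.
move=> yL; rewrite /F big_split /=.
have h1 : \sum_(i < y) e i + \sum_(i < L.+1 - y) e (y + i) = k.
  by rewrite -(sum_shift e) subnKC.
suff E2 : \sum_(i < y) e (L - i) + \sum_(i < L.+1 - y) e i = k.
  rewrite mul2n -addnn -{1}h1 -E2 -!addnA; congr (_ + _); rewrite [RHS]addnC -!addnA. congr (_ + _).
have E := sum_shift (fun i => e (L - i)) y (L.+1 - y); rewrite subnKC // in E.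
rewrite -ek -(sum_rev e) E; congr (_ + _).
have [->|] : L.+1 - y = 0 \/ exists n, L.+1 - y = n.+1.
- by case: (L.+1 - y) => [|n]; [left|right; exists n].
- by rewrite !big_ord0.
move=> [n nE]; rewrite nE -(sum_rev e); apply: eq_bigr => i _; congr (nat_of_bool (e _)).
lia.
Qed.

(** At most one of [i] and [y + i] carries a point, so the two tail sums in [ends_tail] add up to at
    most their length. *)
Lemma ends_hole y : y <= L -> ~~ dif e L y -> 2 * k <= F y + (L.+1 - y).
Proof.
move=> yL hy; rewrite -(@ends_tail y) 1?leqW // -addnA leq_add2l -big_split /=.
apply: (sum_le1 (f := fun i => e i + e (y + i))) => i iL.
case ei : (e i) => //=; case eyi : (e (y + i)) => //.
by case/dif_exP: hy; exists i; split; [|lia|rewrite addnC].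
Qed.

Lemma ends_sym w : w <= L.+1 -> F w + F (L.+1 - w) = 2 * k.
Proof.
move=> wL; rewrite -(ends_tail wL) -addnA; congr (_ + _).
rewrite /F big_split /=; congr (_ + _).
have [->|] : L.+1 - w = 0 \/ exists n, L.+1 - w = n.+1.
- by case: (L.+1 - w) => [|n]; [left|right; exists n].
- by rewrite !big_ord0.
move=> [n nE]; rewrite nE -(sum_rev (fun i => e (w + i))); apply: eq_bigr => i _.
congr (nat_of_bool (e _)); move: (ltn_ord i); lia.
Qed.

(* The path [F w - w] has steps in {-1, 0, 1}; between a hole x and L + 1 - x it descends
   through all levels from 2 * k - L - 2 to 2, and at each such descent w both w and L - w are
   differences. *)
Lemma dense_hole x : L + 3 <= 2 * k -> 0 < x < k -> ~~ dif e L x ->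
  3 * k <= 2 * (\sum_(y < L.+1) dif e L y) + 2.
Proof.
move=> kL /andP[x0 xk] hx.
have [xL|Lx] := leqP (2 * x) L; last first.
  (* A hole beyond the middle is impossible: both ends then overlap in [2 * x - L.+1] places, so
     [F x <= k + (2 * x - L.+1)], and [ends_hole] gives [k <= x]. *)
  exfalso; have [xL|Lx'] := leqP x L; last first.
    have := leq_trans xk; move/(_ L.+1).
    have : k <= L.+1 by rewrite -ek; apply: (sum_le1 (f := e)) => i _; case: e.
    lia.
  have := ends_hole xL hx.
  have hF : F x <= k + (2 * x - L.+1).
    have hx2 : L.+1 - x <= x by lia.
    rewrite /F big_split /=.
    have h1 := sum_shift (fun i => e (L - i)) (L.+1 - x) (2 * x - L.+1).
    have E : L.+1 - x + (2 * x - L.+1) = x by lia.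
    rewrite E in h1; rewrite h1.
    have h2 : \sum_(i < 2 * x - L.+1) e (L - (L.+1 - x + i)) <= 2 * x - L.+1.
      by apply: (sum_le1 (f := fun i => e (L - (L.+1 - x + i)))) => i _; case: e.
    have h3 : \sum_(i < x) e i + \sum_(i < L.+1 - x) e (L - i) = k.
      have E2 := sum_shift e x (L.+1 - x); rewrite subnKC ?(leqW xL) // in E2.
      rewrite -ek E2; congr (_ + _).
      have nE : L.+1 - x = (L - x).+1 by lia.
      rewrite nE -(sum_rev (fun i => e (x + i))); apply: eq_bigr => i _.
      congr (nat_of_bool (e _)); move: (ltn_ord i); lia.
    by rewrite addnA h3 leq_add2l.
  lia.
pose m := 2 * k - L.
pose down w := [&& F w.+1 == F w, w + 2 <= F w & F w + 2 <= w + m].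
(* Clamping to [[1, m - 2]] lets [psi] decrease only where [down] holds, and only by 1. It falls
   from [m - 2] at [x] to 1 at [L.+1 - x], hence [m - 3] descents. *)
pose psi w := minn (m - 2) (maxn 1 (F w - w)).
have FS w : F w.+1 = F w + (e w + e (L - w)) by rewrite /F big_ord_recr.
have path d : psi x <= psi (x + d) + \sum_(i < d) down (x + i).
  elim: d => [|d IHd]; first by rewrite addn0 big_ord0 addn0.
  rewrite big_ord_recr /=; apply: leq_trans IHd _.
  rewrite addnS addnA addnAC leq_add2r /down /psi FS.
  move: (e _ + e _) => s; case: eqP; lia.
have xL' : x <= L by lia.
have Fx := ends_hole xL' hx.
have Fz := ends_sym (leqW xL').
have hd : m - 3 <= \sum_(i < L.+1) down i.
  have := path (L.+1 - x - x).
  have -> : x + (L.+1 - x - x) = L.+1 - x by lia.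
  have -> : psi x = m - 2 by rewrite /psi /m; lia.
  have -> : psi (L.+1 - x) = 1 by rewrite /psi /m; lia.
  have := sum_shift down x (L.+1 - x - x + x).
  have -> : x + (L.+1 - x - x + x) = L.+1 by lia.
  move=> ->; rewrite (sum_shift (fun i => down (x + i))).
  by move: (\sum_(i < L.+1 - x - x) _) => s; lia.
(* If [w] and [L - w] were both holes, then [2 * k <= L + 2]; this gives the summand 1. A point at
   [w] or [L - w], or a descent at [w], makes both of them differences. *)
have pt (w : 'I_L.+1) : 1 + e w + down w <= dif e L w + dif e L (L - w).
  have wL : w <= L by rewrite -ltnS.
  case ew : (e w).
    rewrite (dif_left wL ew) (dif_right wL ew) /down FS ew.
    by case: eqP => //; lia.
  case eLw : (e (L - w)).
    have Lw : L - w <= L by lia.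
    have := dif_right Lw eLw; rewrite subKn // => ->.
    rewrite (dif_left Lw eLw) /down FS eLw.
    by case: eqP => //; lia.
  have Fw := ends_sym (leqW wL).
  case h1 : (dif e L w).
    case h2 : (dif e L (L - w)); first by case: (down w).
    have := ends_hole (leq_subr w L) (negbT h2).
    have Fw' := ends_sym (ltn_ord w : w.+1 <= L.+1).
    rewrite subSS in Fw'.
    rewrite /down; case: eqP => //=; lia.
  have := ends_hole wL (negbT h1).
  case h2 : (dif e L (L - w)); first by rewrite /down; case: eqP => //=; lia.
  have := ends_hole (leq_subr w L) (negbT h2).
  have Fw' := ends_sym (ltn_ord w : w.+1 <= L.+1).
  rewrite subSS in Fw'; move: (FS w); rewrite ew eLw; lia.
have : \sum_(w < L.+1) (1 + e w + down w) <= \sum_(w < L.+1) (dif e L w + dif e L (L - w)).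
  by apply: leq_sum => w _; apply: pt.
rewrite !big_split /= sum1_card card_ord ek (sum_rev (fun i => dif e L i)).
by move: hd; move: (\sum_(i < _) _) (\sum_(i < _) dif e L i) => s t; lia.
Qed.

End Differences.

Lemma cross_sub_inj x y a b : a <= x -> b <= y -> b < a -> y < a -> x - b = a - y -> x = a.
Proof. lia. Qed.

(** * Reduction modulo the diameter *)

Section CyclicGroup.
Local Open Scope group_scope.

Lemma val_divZp l (a b : 'I_l.+1) :
  val (a * b^-1) = if b <= a then a - b else l.+1 + a - b.
Proof.
have ha := ltn_ord a; have hb := ltn_ord b.
rewrite /= modnDmr; case: leqP => h.
  have -> : a + (l.+1 - b) = a - b + l.+1 by lia.
  by rewrite modnDr modn_small //; lia.
by rewrite modn_small; lia.
Qed.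

Lemma abelianZp l : abelian [set: 'I_l.+1].
Proof. by apply/centsP=> x _ y _; apply: Zp_mulgC. Qed.

End CyclicGroup.

Section Sparse.
Local Open Scope group_scope.
Variables (e : pred nat) (l k : nat).
Local Notation L := l.+1.
Hypotheses (e0 : e 0) (eL : e L) (ek : \sum_(i < L.+1) e i = k).

(* A residue modulo L lies in U if it lifts to a difference in [0, L), and in V if it lifts to one
   in [-L, 0). *)
Let U := [set y : 'I_L | dif e L y].
Let V := [set y : 'I_L | dif e L (L - y)].
Let X := [set y : 'I_L | e y].

Lemma card_residues : #|X| + 1 = k.
Proof. by rewrite -ek big_ord_recr /= eL sum_pred_card. Qed.

Lemma card_low_differences : #|U| + 1 = \sum_(y < L.+1) dif e L y.
Proof.
rewrite big_ord_recr /= (sum_pred_card (dif e L)); congr (_ + _).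
by rewrite (dif_left e0 _ eL).
Qed.

Lemma card_high_differences : #|V| + 1 = \sum_(y < L.+1) dif e L y.
Proof.
rewrite -(sum_rev (fun i => dif e L i)) big_ord_recr /= (sum_pred_card (fun y => dif e L (L - y))); congr (_ + _).
by rewrite subnn (dif_left e0 _ e0).
Qed.

Lemma div_inU a b : a \in X -> b \in X -> b <= a -> a * b^-1 \in U.
Proof.
rewrite !inE => ea eb h; rewrite val_divZp h; apply/dif_exP; exists b.
by have := ltn_ord a; split=> //; [lia|rewrite subnKC].
Qed.

Lemma div_inV a b : a \in X -> b \in X -> a < b -> a * b^-1 \in V.
Proof.
rewrite !inE => ea eb h; rewrite val_divZp leqNgt h /=; apply/dif_exP; exists a.
have ha := ltn_ord a; have hb := ltn_ord b.
split=> //; first by lia.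
by have -> : a + (L - (L + a - b)) = b by lia.
Qed.

(** Both 0 and [L] are points, so a point [y] lifts to the differences [y - 0] and [y - L]. *)
Lemma X_sub_UV : X \subset U :&: V.
Proof.
apply/subsetP=> y; rewrite !inE => ey; have hy := ltn_ord y.
by rewrite (dif_left e0) ?(ltnW hy) //= (dif_right eL) // ltnW.
Qed.

Lemma XX_sub_UV : X * X^-1 \subset U :|: V.
Proof.
apply/subsetP=> _ /mulsgP[a b aX bX ->]; rewrite inE.
rewrite mem_invg in bX; rewrite -[b]invgK.
have [h|h] := leqP (b^-1 : 'I_L) a; first by rewrite (div_inU aX bX h).
by rewrite (div_inV aX bX h) orbT.
Qed.

(** This is the integer bound |A - B| >= |A| + |B| - 1, split by sign. [P1] consists of differences
    at least [m1 - m2] and [P2] of nonnegative ones at most [m1 - m2], so inside [U] they share at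
    most one element; the elements of [X2] above [m1] give [P3] inside [V]. *)
Lemma class_count_lt (X1 X2 W : {set 'I_L}) m1 m2 :
  X1 \subset X -> X2 \subset X -> [disjoint X1 & X2] -> X1 * X2^-1 \subset W ->
  m1 \in X1 -> m2 \in X2 -> (forall x, x \in X1 -> m1 <= x) ->
  (forall x, x \in X2 -> m2 <= x) -> m2 < m1 ->
  #|X1| + #|X2| <= #|U :&: W| + #|V :&: W| + 1.
Proof.
move=> s1 s2 dis sW m1X m2X min1 min2 lt.
have inW x y : x \in X1 -> y \in X2 -> x * y^-1 \in W.
  by move=> xX yX; apply: (subsetP sW); rewrite mem_mulsg // mem_invg invgK.
pose lo := [set y in X2 | y < m1]; pose hi := [set y in X2 | m1 < y].
have X2E : #|X2| = #|lo| + #|hi|.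
  rewrite -(cardsID [set y : 'I_L | y < m1] X2).
  have -> : X2 :&: [set y : 'I_L | y < m1] = lo by apply/setP=> y; rewrite !inE.
  suff -> : X2 :\: [set y : 'I_L | y < m1] = hi by [].
  apply/setP=> y; rewrite !inE -leqNgt andbC; case yX : (y \in X2) => //=.
  rewrite leq_eqVlt; case: eqP => //= /val_inj ym.
  by move/pred0P: dis => /(_ y) /=; rewrite -{1}ym m1X yX.
pose P1 := [set x * m2^-1 | x in X1]; pose P2 := [set m1 * y^-1 | y in lo].
pose P3 := [set m1 * y^-1 | y in hi].
have c1 : #|P1| = #|X1| by rewrite card_imset //; apply: mulIg.
have injd : injective (fun y : 'I_L => m1 * y^-1) by move=> y y' /mulgI /invg_inj.
have c2 : #|P2| = #|lo| by rewrite card_imset.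
have c3 : #|P3| = #|hi| by rewrite card_imset.
have sP12 : P1 :|: P2 \subset U :&: W.
  rewrite subUset; apply/andP; split; apply/subsetP=> w /imsetP[y yX ->].
     rewrite inE inW // andbT; apply: div_inU; [exact: (subsetP s1)|exact: (subsetP s2)|].
    exact: leq_trans (ltnW lt) (min1 _ yX).
  move: yX; rewrite [y \in _]inE => /andP[yX ym]; rewrite inE inW // andbT.
  by apply: div_inU; [exact: (subsetP s1)|exact: (subsetP s2)|exact: ltnW].
have sP3 : P3 \subset V :&: W.
  apply/subsetP=> w /imsetP[y yX ->]; move: yX; rewrite [y \in _]inE => /andP[yX ym]; rewrite inE inW // andbT.
  by apply: div_inV; [exact: (subsetP s1)|exact: (subsetP s2)|].
have sI : P1 :&: P2 \subset [set m1 * m2^-1].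
  apply/subsetP=> w /setIP[/imsetP[x xX ->] /imsetP[y yX E]].
  move: yX; rewrite [y \in _]inE => /andP[yX ym].
  apply/set1P; congr (_ * _).
  have := congr1 val E; rewrite !val_divZp (ltnW ym).
  have h1 := min1 x xX; have h2 := min2 y yX.
  rewrite (leq_trans (ltnW lt) h1) => h3; apply: val_inj; exact: cross_sub_inj h1 h2 lt ym h3.
have := subset_leq_card sP12; have := subset_leq_card sP3; have := subset_leq_card sI.
rewrite cards1 c3 X2E -c1 -c2.
have := cardsUI P1 P2; move: (#|P1 :|: P2|) (#|P1 :&: P2|) (#|P1|) (#|P2|) (#|U :&: W|) (#|V :&: W|).
move: #|hi|; clear; lia.
Qed.

(** If the minimum of [X1] is the smaller one, the two sets are exchanged and [W] is inverted.
    Inversion swaps [U] and [V] away from the identity, hence the condition on [W]. *)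
Lemma class_count (X1 X2 W : {set 'I_L}) :
  X1 \subset X -> X2 \subset X -> [disjoint X1 & X2] -> X1 * X2^-1 \subset W ->
  X1 != set0 -> X2 != set0 -> 1 \notin W ->
  #|X1| + #|X2| <= #|U :&: W| + #|V :&: W| + 1.
Proof.
move=> s1 s2 dis sW /set0Pn[x1 x1X] /set0Pn[x2 x2X] W1.
have [m1 m1X min1] := arg_minnP (fun x : 'I_L => x : nat) x1X.
have [m2 m2X min2] := arg_minnP (fun x : 'I_L => x : nat) x2X.
have [lt|lt|/val_inj eq12] := ltngtP m2 m1.
  exact: (class_count_lt (m1 := m1) (m2 := m2)).
  have sW' : X2 * X1^-1 \subset W^-1.
    by rewrite -[X2]invgK -invMg invSg.
  have nz (y : 'I_L) : y^-1 \in W -> 0 < y.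
    move=> yW; rewrite lt0n; apply: contra W1 => /eqP y0.
    suff <- : y^-1 = 1 by [].
    by apply: val_inj; rewrite /= y0 subn0 modnn.
  have := class_count_lt (W := W^-1) s2 s1 _ sW' m2X m1X min2 min1 lt.
  rewrite disjoint_sym addnC => /(_ dis).
  have vinv (y : 'I_L) : 0 < y -> val y^-1 = L - y.
    by move=> y0; rewrite /= modn_small // ltn_subrL y0.
  have ->: U :&: W^-1 = (V :&: W)^-1.
    apply/setP=> y; rewrite mem_invg 2!inE mem_invg [in RHS]inE.
    case yW : (y^-1 \in W); rewrite ?andbF // !andbT [y^-1 \in V]inE.
    by rewrite vinv ?nz // subKn // ltnW.
  have ->: V :&: W^-1 = (U :&: W)^-1.
    apply/setP=> y; rewrite mem_invg 2!inE mem_invg [in RHS]inE.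
    case yW : (y^-1 \in W); rewrite ?andbF // !andbT [y^-1 \in U]inE.
    by rewrite vinv ?nz.
  by rewrite !card_invg (addnC #|V :&: W|).
have m1X1 : m1 \in X1 := m1X; have m2X2 : m2 \in X2 := m2X.
by have := disjointFr dis m1X1; rewrite -eq12 m2X2.
Qed.

Hypothesis gcd1 : forall g, (forall i, i <= L -> e i -> g %| i) -> g = 1%N.

(** The least positive integer with residue in [H] divides all others, including [L] and every
    point, so it is 1. *)
Lemma subgroup_full (H : {group 'I_L}) : X \subset H -> H :=: [set: 'I_L].
Proof.
move=> sXH; have LH : (0 < L) && (inZp L \in H).
  suff -> : inZp L = 1%g :> 'I_L by rewrite group1.
  by apply: val_inj; rewrite /= modnn.
have exd : exists d, (0 < d) && (inZp d \in H) by exists L.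
case: (ex_minnP exd) => d /andP[d0 dH] mind.
have XP (m : nat) i : inZp (m * i) = (inZp i : 'I_L) ^+ m.
  elim: m => [|m IHm]; first by apply: val_inj; rewrite /= mod0n.
  by rewrite expgS -IHm; apply: val_inj; rewrite /= mulSn modnDm.
have dvd i : inZp i \in H -> d %| i.
  move=> iH; rewrite /dvdn; apply/negPn/negP; rewrite -lt0n => r0.
  have : d <= i %% d.
    apply: mind; rewrite r0 /=.
    suff -> : (inZp (i %% d) : 'I_L) = inZp i * (inZp (i %/ d * d))^-1.
      by rewrite groupM // groupV XP groupX.
    apply: (canRL (mulgK _)); apply: val_inj; rewrite /= modnDm addnC.
    by rewrite -divn_eq.
  by rewrite leqNgt ltn_mod d0.
have d1 : d = 1%N.
  apply: gcd1 => i iL ei; apply: dvd.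
  move: iL; rewrite leq_eqVlt => /orP[/eqP ->|iL]; first by case/andP: LH.
  apply: (subsetP sXH); rewrite inE /= modn_small //.
apply/setP=> x; rewrite inE; rewrite d1 in dH.
have -> : x = inZp 1 ^+ x by rewrite -XP muln1; apply: val_inj; rewrite /= modn_small.
by rewrite groupX.
Qed.

(** Since [#|U| + #|V| = #|U :|: V| + #|U :&: V|], a lower bound for [#|Y| + #|U :&: V|] suffices.
    Kneser's bound on [Y] is too weak only if [H] is large compared with the number [#|T|] of gaps
    of [X] in its cosets. Then a coset [W] in [Y] outside [X * H] contains at least
    [#|H| - #|T| - 1] residues that lift both ways, in addition to those in [X]. *)
Lemma sparse_card : 2 <= k -> 2 * k <= L + 2 ->
  3 * k <= 2 * (\sum_(y < L.+1) dif e L y) + 2.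
Proof.
move=> k2 kL; have cX := card_residues; have cU := card_low_differences; have cV := card_high_differences.
have UV : #|U :|: V| + #|U :&: V| = #|U| + #|V| := cardsUI U V.
pose Y := X * X^-1.
have leY : #|Y| <= #|U :|: V| := subset_leq_card XX_sub_UV.
have leX : #|X| <= #|U :&: V| := subset_leq_card X_sub_UV.
suff : 3 * k <= #|Y| + #|U :&: V| + 4.
  move: leY UV cU cV; move: (#|Y|) (#|U :&: V|) (#|U :|: V|) (#|U|) (#|V|) (\sum_(y < _) _); clear; lia.
have x0 : 1 \in X by rewrite inE.
have X0 : X != set0 by apply/set0Pn; exists 1.
have [|H [YH cH]] := kneser (abelianZp l) X0 (B := X^-1).
  by apply/set0Pn; exists 1; rewrite mem_invg invg1.
rewrite -/Y in YH cH.
have cXV : #|X^-1 * H| = #|X * H|.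
  by rewrite -[RHS]card_invg invMg invGid (abelian_mulsC (abelianZp l) X^-1).
rewrite cXV in cH.
pose T := X * H :\: X.
have sXH : X \subset X * H by rewrite -{1}[X]mulg1 mulgS // sub1G.
have sHX : H \subset X * H by rewrite -{1}[gval H]mul1g mulSg // sub1set.
have cT : #|T| + #|X| = #|X * H|.
  by rewrite /T cardsD (setIidPr sXH) subnK // subset_leq_card.
have [small|big] := leqP #|H| (2 * #|T| + 1).
  move: small cT cH leX cX k2; move: (#|H|) (#|T|) (#|Y|) (#|X * H|) (#|X|) (#|U :&: V|); clear; lia.
(* If [Y] stays inside [X * H], Kneser's inequality leaves a single coset, and the gcd condition
   makes it the whole group. *)
have [sYX|/subsetPn[z zY zX]] := boolP (Y \subset X * H).
  have eqXH : H :=: X * H.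
    apply/eqP; rewrite eqEcard sHX.
    have := subset_leq_card sYX; move: cH.
    move: (#|X * H|) (#|Y|) (#|H|); clear; lia.
  have HT := subgroup_full (eq_ind_r (fun S : {set 'I_L} => X \subset S) sXH eqXH).
  have YT : #|Y| = L.
    have sHY : H \subset Y.
      rewrite -YH -{1}[gval H]mul1g mulSg // sub1set -[1]mulg1 mem_mulsg //.
      by rewrite mem_invg invg1.
    have YL : #|Y| <= L by rewrite (leq_trans (max_card _)) // card_ord.
    apply/eqP; rewrite eqn_leq YL /=.
    by apply: leq_trans (subset_leq_card sHY); rewrite HT cardsT card_ord.
  move: YT leX cX kL; move: (#|Y|) (#|X|) (#|U :&: V|); clear; lia.
have /mulsgP[x1 x2' x1X x2X zE] := zY.
rewrite mem_invg in x2X; pose x2 := x2'^-1.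
pose X1 := X :&: x1 *: H; pose X2 := X :&: x2 *: H; pose W := z *: H.
have zE' : z = x1 * x2^-1 by rewrite invgK.
have cosXH x : x \in X -> x *: H \subset X * H by move=> xX; rewrite mulSg // sub1set.
have disW : [disjoint W & X * H].
  apply/pred0P=> w /=; apply/negP=> /andP[/lcosetP[h hH ->] /mulsgP[x h' xX h'H E]].
  case/negP: zX; rewrite -(mulgK h z) E -mulgA mem_mulsg // groupM ?groupV //.
have dis12 : [disjoint x1 *: H & x2 *: H].
  apply/pred0P=> w /=; apply/negP=> /andP[/lcosetP[h hH ->] /lcosetP[h' h'H E]].
  case/negP: zX; apply: (subsetP sHX).
  rewrite zE' (abelian_mulgC (abelianZp l)).
  have -> : x2^-1 * x1 = h' * h^-1 by rewrite -(mulgK h x1) E -!mulgA mulKg.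
  by rewrite groupM ?groupV.
have c12 : 2 * #|H| <= #|X1| + #|X2| + #|T|.
  have e1 := cardsID X (x1 *: H); have e2 := cardsID X (x2 *: H).
  rewrite !card_lcoset ![_ :&: X]setIC -/X1 -/X2 in e1 e2.
  have : #|(x1 *: H :\: X) :|: (x2 *: H :\: X)| <= #|T|.
    by apply: subset_leq_card; rewrite subUset !setSD // cosXH.
  have -> : #|(x1 *: H :\: X) :|: (x2 *: H :\: X)| = #|x1 *: H :\: X| + #|x2 *: H :\: X|.
    apply/eqP; rewrite (leq_card_setU _ _).2.
    by apply: disjointW dis12; apply: subsetDl.
  move: e1 e2; move: (#|X1|) (#|X2|) (#|T|) (#|H|) (#|x1 *: H :\: X|) (#|x2 *: H :\: X|); clear; lia.
have cc : #|X1| + #|X2| <= #|U :&: W| + #|V :&: W| + 1.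
  apply: class_count.
  - exact: subsetIl.
  - exact: subsetIl.
  - by apply: disjointW dis12; apply: subsetIr.
  - apply/subsetP=> _ /mulsgP[y y' /setIP[_ /lcosetP[h hH ->]] + ->].
    rewrite mem_invg => /setIP[_ /lcosetP[h' h'H E]].
    rewrite -[y']invgK E mem_lcoset zE' !invMg invgK.
    have -> : x2 * x1^-1 * (x1 * h * (h'^-1 * x2^-1)) = h * h'^-1.
      by rewrite (abelian_mulgC (abelianZp l) h'^-1) !mulgA mulgKV (abelian_mulgC (abelianZp l) x2) mulgK.
    by rewrite groupM ?groupV.
  - by apply/set0Pn; exists x1; rewrite inE x1X lcoset_refl.
  - by apply/set0Pn; exists x2; rewrite inE x2X lcoset_refl.
  - by apply: contraT; rewrite negbK => W1; have := disjointFr disW W1; rewrite (subsetP sXH).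
have cI : #|X| + #|U :&: V :&: W| <= #|U :&: V|.
  rewrite -(cardsID W (U :&: V)) addnC leq_add2l; apply: subset_leq_card.
  apply/subsetP=> x xX; rewrite inE (subsetP X_sub_UV) // andbT.
  by rewrite (disjointFl disW) // (subsetP sXH).
have cW : #|U :&: W| + #|V :&: W| <= #|U :&: V :&: W| + #|H|.
  rewrite -cardsUI -setIUl -setIIl addnC leq_add2l -(card_lcoset H z) subset_leq_card //.
  exact: subsetIr.
move: cI cW cc c12 cT cH cX big k2.
move: (#|X|) (#|U :&: V :&: W|) (#|U :&: V|) (#|U :&: W|) (#|V :&: W|) (#|H|) (#|X1|) (#|X2|) (#|T|) (#|Y|) (#|X * H|).
clear; lia.
Qed.

End Sparse.

(** * Dilations of a sum-free set *)

Lemma freiman_difference (e : pred nat) L k :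
  e 0 -> e L -> \sum_(i < L.+1) e i = k ->
  (forall g, (forall i, i <= L -> e i -> g %| i) -> g = 1) ->
  2 * (\sum_(y < L.+1) dif e L y) + 2 < 3 * k ->
  forall x, 0 < x < k -> dif e L x.
Proof.
move=> e0 eL ek gcd1 small x xk; apply: contraLR small => hx; rewrite -leqNgt.
case: L => [|l] in e0 eL ek gcd1 hx *.
  by move: ek; rewrite big_ord1 e0; lia.
have [kL|kL] := leqP (2 * k) (l.+1 + 2); last by apply: (dense_hole e0 eL ek) hx; lia.
by apply: sparse_card e0 eL ek gcd1 _ kL; lia.
Qed.

Section HalfArcDilation.
Variables (q : nat) (a : pred nat).
Local Notation p := (2 * q).+1.
Hypothesis per : forall x, a (x + p) = a x.
Hypothesis sf : forall x y, a x -> a y -> ~~ a (x + y).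

Lemma periodic_addM x m : a (x + m * p) = a x.
Proof. by elim: m => [|m IHm]; rewrite ?addn0 // mulSnr addnA per. Qed.

Lemma leq_sum_inj m n (f g : pred nat) (h : nat -> nat) :
  (forall i, i < m -> f i -> h i < n /\ g (h i)) ->
  (forall i j, i < m -> j < m -> f i -> f j -> h i = h j -> i = j) ->
  \sum_(i < m) f i <= \sum_(i < n) g i.
Proof.
move=> hfg inj; case: n => [|n] in hfg *.
  rewrite big1 // => i _; case fi : (f i) => //.
  by have [] := hfg i (ltn_ord i) fi.
rewrite !sum_pred_card.
rewrite -(card_in_imset (f := fun i : 'I_m => inord (h i) : 'I_n.+1)).
  apply: subset_leq_card; apply/subsetP=> w /imsetP[i + ->]; rewrite !inE => fi.
  by have [hn gh] := hfg i (ltn_ord i) fi; rewrite inordK.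
move=> i j; rewrite !inE => fi fj /(congr1 val) /=.
have [hn _] := hfg i (ltn_ord i) fi; have [hn' _] := hfg j (ltn_ord j) fj.
by rewrite !inordK // => E; apply: val_inj; apply: (inj i j).
Qed.

(** Dilates are written as [y] with [a (d * y)], that is, dilation by the inverse of [d], so that no
    modular inverse appears here. *)
Lemma half_arc_dilation s k : \sum_(i < q.+1) a (s + i) = k -> p + 4 <= \sum_(i < p) a i + 3 * k ->
  exists d, 0 < d < p /\ (forall y, y < p -> a (d * y) -> k <= y /\ y + k <= p).
Proof.
move=> kE big; set n := \sum_(i < p) a i in big.
have nC : n + \sum_(i < p) ~~ a i = p.
  rewrite /n -big_split /= -[RHS]card_ord -sum1_card.
  by apply: eq_bigr => i _; case: (a i).
have k2 : 2 <= k by move: big nC; move: n (\sum_(i < p) _) => n m; clear; lia.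
have exi : exists i, (i <= q) && a (s + i).
  have : 0 < k by apply: ltnW.
  rewrite -kE lt0n sum_nat_eq0 negb_forall => /existsP[i]; rewrite /= eqb0 negbK => ai.
  by exists i; rewrite -ltnS ltn_ord.
have bound i : (i <= q) && a (s + i) -> i <= q by case/andP.
case: (ex_minnP exi) => i0 /andP[i0q ai0] min0.
case: (ex_maxnP exi bound) => i1 /andP[i1q ai1] max1.
have range i : i < q.+1 -> a (s + i) -> i0 <= i <= i1.
  by rewrite ltnS => iq ai; rewrite min0 ?max1 ?iq.
pose L0 := i1 - i0; pose e' i := a (s + i0 + i).
have i01 : i0 <= i1 by apply: max1; rewrite i0q.
have e'0 : e' 0 by rewrite /e' addn0.
have e'L : e' L0 by rewrite /e' -addnA subnKC.
pose d := \big[gcdn/0]_(i < L0.+1 | e' i) i.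
have dP g : reflect (forall i, i <= L0 -> e' i -> g %| i) (g %| d).
  apply: (iffP (dvdn_biggcdP _ _ _)) => h i.
    by rewrite -ltnS => iL ei; apply: (h (Ordinal iL)).
  by move=> ei; apply: h => //; rewrite -ltnS.
have /dP dd : d %| d by [].
have dL : d %| L0 by apply: dd.
pose L := L0 %/ d; pose e i := e' (d * i).
have LE : d * L = L0 by rewrite mulnC divnK.
have e0 : e 0 by rewrite /e muln0.
have eL : e L by rewrite /e LE.
have L0gt : 0 < L0.
  rewrite lt0n; apply/negP=> /eqP L00.
  have : k <= \sum_(i < 1) xpredT (i : nat).
    rewrite -kE; apply: (@leq_sum_inj _ _ (fun i => a (s + i)) xpredT (fun _ => 0)) => // i j iq jq ai aj _.
    by move: (range i iq ai) (range j jq aj) L00; rewrite /L0; clear; lia.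
  by rewrite big_ord1 leqNgt k2.
have d0 : 0 < d by apply: dvdn_gt0 dL.
pose k' := \sum_(i < L.+1) e i.
have kk' : k <= k'.
  rewrite -kE; apply: (@leq_sum_inj _ _ (fun i => a (s + i)) e (fun i => (i - i0) %/ d)).
    move=> i iq ai; have /andP[h1 h2] := range i iq ai.
    have ei : e' (i - i0) by rewrite /e' -addnA subnKC.
    have hL : i - i0 <= L0 by apply: leq_sub2r.
    split; first by rewrite ltnS leq_div2r.
    by rewrite /e mulnC divnK // dd.
  move=> i j iq jq ai aj E.
  have /andP[h1 h2] := range i iq ai; have /andP[h3 h4] := range j jq aj.
  have di : d %| i - i0 by apply: dd; [apply: leq_sub2r|rewrite /e' -addnA subnKC].
  have dj : d %| j - i0 by apply: dd; [apply: leq_sub2r|rewrite /e' -addnA subnKC].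
  by have := congr1 (muln^~ d) E; rewrite /= !divnK //; move: h1 h3; clear; lia.
have gcd1 g : (forall i, i <= L -> e i -> g %| i) -> g = 1.
  move=> h; have : d * g %| d.
    apply/dP=> i iL ei; have di := dd i iL ei.
    rewrite -(divnK di) mulnC dvdn_pmul2r //; apply: h; first exact: leq_div2r.
    by rewrite /e mulnC divnK.
  by rewrite -{2}[d]muln1 dvdn_pmul2l // dvdn1 => /eqP.
have dLq : d * L <= q by rewrite LE; apply: leq_trans (leq_subr _ _) i1q.
have difa y : dif e L y -> ~~ a (d * y) /\ (forall w m, w + d * y = m * p -> ~~ a w).
  case/dif_exP=> i [ei iL eiy]; rewrite /e /e' in ei eiy.
  set u := s + i0 + d * i in ei.
  have eu : s + i0 + d * (i + y) = u + d * y by rewrite mulnDr addnA.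
  rewrite eu in eiy; split.
    by apply: contraL eiy => ay; apply: sf.
  move=> w m wE; apply: contraL ei => aw.
  by rewrite -(periodic_addM u m) -wE addnCA; apply: sf.
have yq y : y < L.+1 -> d * y <= q.
  by rewrite ltnS => yL; apply: leq_trans dLq; rewrite leq_mul2l yL orbT.
(* The residues [d * y] lie in [[0, q]] and the [p - d * y] with [y > 0] in [(q, p)], so they are
   distinct; only 0 is counted once, hence the [+ 1]. With [big] this gives
   [2 * D + 2 <= p + 3 - n < 3 * k] for the number [D] of differences. *)
have cD : n + 2 * (\sum_(y < L.+1) dif e L y) <= p + 1.
  have pE : p = q.+1 + q by clear; lia.
  have c1 : \sum_(y < L.+1) dif e L y <= \sum_(i < q.+1) ~~ a i.
    apply: (@leq_sum_inj _ _ (dif e L) (fun i => ~~ a i) (muln d)).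
      by move=> y yL hy; rewrite ltnS yq //; have [] := difa y hy.
    by move=> i j _ _ _ _ /eqP; rewrite eqn_pmul2l // => /eqP.
  have c2 : \sum_(y < L) dif e L y.+1 <= \sum_(i < q) ~~ a (q.+1 + i).
    apply: (@leq_sum_inj _ _ (fun y => dif e L y.+1) (fun i => ~~ a (q.+1 + i)) (fun y => q - d * y.+1)).
      move=> y yL hy; have := yq y.+1 yL => yq'.
      have [_ h] := difa _ hy.
      have dy : 0 < d * y.+1 by rewrite muln_gt0 d0.
      by split; [|apply: (h _ 1)]; move: dy yq'; clear; lia.
    move=> i j iL jL _ _; have := yq i.+1 iL; have := yq j.+1 jL => h1 h2 E.
    have /eqP : d * i.+1 = d * j.+1 by move: h1 h2 E; clear; lia.
    by rewrite eqn_pmul2l // => /eqP [].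
  have := nC; rewrite pE (sum_shift (fun i => ~~ a i)).
  have : \sum_(y < L.+1) dif e L y = dif e L 0 + \sum_(y < L) dif e L y.+1 by rewrite big_ord_recl.
  rewrite (dif_left e0 _ e0) //=; move: c1 c2.
  move: (\sum_(i < L.+1) _) (\sum_(i < L) _) (\sum_(i < q.+1) _) (\sum_(i < q) _); clear; lia.
have freiman := freiman_difference e0 eL (erefl k') gcd1.
have {}freiman x : 0 < x < k -> dif e L x.
  move=> xk; apply: freiman; last by case/andP: xk => -> xk; exact: leq_trans xk kk'.
  by move: cD big kk'; clear; move: (\sum_(i < L.+1) _) n k' => D n k'; lia.
have dif0 : dif e L 0 := dif_left e0 (leq0n _) e0.
exists d; split.
  rewrite d0 ltnS; apply: leq_trans (dvdn_leq L0gt dL) _; move: i1q; rewrite /L0; clear; lia.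
move=> y yp ay; split; rewrite leqNgt; apply: contraL ay => hy.
  have [->|y0] := posnP y; first by have [] := difa 0 dif0.
  have /freiman/difa[] // : 0 < y < k by rewrite y0.
have /freiman/difa[_ h] : 0 < p - y < k by move: yp hy; clear; lia.
by apply: (h _ d); rewrite -mulnDr subnKC // ltnW.
Qed.

End HalfArcDilation.

(** * Fourier analysis on half-arcs *)

Section StdlibReals.
Local Open Scope R_scope.

(** As [PI >= 3], the sine is at least [sin y] with [y = 3 * (v / p) <= 0.44], and there
    [y - y ^ 3 / 6 >= 29 / 30 * y]. *)
Lemma sin_lower (v p : R) : 0 <= v -> 0 < p -> v <= 146 / 1000 * p ->
  29 / 10 * v <= p * sin (PI / p * v).
Proof.
move=> v0 p0 vp; have h := PI2_3_2; have h4 := PI_4.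
pose y := 3 * (v / p).
have vp0 : 0 <= v / p by apply: Rle_mult_inv_pos.
have vpE : v / p * p = v by rewrite /Rdiv Rmult_assoc Rinv_l ?Rmult_1_r //; exact: Rgt_not_eq.
have vp1 : v / p <= 146 / 1000.
  by apply: (Rmult_le_reg_r p) => //; rewrite vpE.
have y0 : 0 <= y by rewrite /y; Lra.lra.
have y1 : y <= 44 / 100 by rewrite /y; Lra.lra.
have xE : PI / p * v = PI * (v / p) by rewrite /Rdiv Rmult_assoc (Rmult_comm (/ p)).
have inc : sin y <= sin (PI / p * v).
  by rewrite xE; apply: sin_incr_1; rewrite /y; Lra.nra.
have lb : 29 / 30 * y <= sin y.
  have [||lb _] := pre_sin_bound y 0; [Lra.lra|Lra.lra|].
  apply: Rle_trans lb; rewrite /sin_approx /sum_f_R0 /sin_term /=.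
  have y2 : y * y <= 1936 / 10000 by Lra.nra.
  have y3 : y * (y * (y * 1)) <= 1936 / 10000 * y by Lra.nra.
  Lra.lra.
have -> : 29 / 10 * v = p * (29 / 30 * y) by rewrite /y -{1}vpE; Lra.lra.
by apply: Rmult_le_compat_l; Lra.lra.
Qed.

(* Here P = p, t = 2 k - n, c is the real part of the Fourier coefficient and z is the sum of the
   sines over a half-period; 57 / 400 < 0.313 ^ 2 / 0.687 and t <= 0.1452 P. *)
Lemma half_arc_numeric (T t n P c z s : R) :
  P * (s / 2 - z * c) <= P * (t * z) - 29 / 10 * T -> 6 * T + t = t * (t * t) -> 0 <= T -> 0 <= t ->
  3 * t + 5 * n <= 2 * P + 6 -> 313 * P <= 1000 * n -> 10000 <= P -> n < P ->
  c * (P - n) <= - (n * n) -> 2 * z <= P -> 0 < z -> 0 <= s -> False.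
Proof.
move=> V TE T0 t0 tn nP P0 nltP cn zP z0 s0.
have mlow : 57 / 400 * P <= - c.
  case: (Rle_lt_dec (57 / 400 * P) (- c)) => // small.
  have h1 : 313 / 1000 * P * (313 / 1000 * P) <= n * n by apply: Rmult_le_compat; Lra.lra.
  have h2 : - c * (P - n) <= 57 / 400 * P * (P - n) by apply: Rmult_le_compat_r; Lra.lra.
  have h3 : 57 / 400 * P * (P - n) <= 57 / 400 * P * (687 / 1000 * P).
    by apply: Rmult_le_compat_l; Lra.lra.
  have P2 : 0 < P * P by apply: Rmult_lt_0_compat; Lra.lra.
  Lra.lra.
have key : 29 / 10 * T <= P * z * (t + c).
  have : 0 <= P * s by apply: Rmult_le_pos; Lra.lra.
  Lra.lra.
have Pz : 0 < P * z by apply: Rmult_lt_0_compat; Lra.lra.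
have tc : 0 <= t + c.
  case: (Rle_lt_dec 0 (t + c)) => // neg.
  have : 0 < P * z * - (t + c) by apply: Rmult_lt_0_compat; Lra.lra.
  Lra.lra.
have key2 : P * z * (t + c) <= P * (P / 2) * (t + c).
  by apply: Rmult_le_compat_r => //; apply: Rmult_le_compat_l; Lra.lra.
have t2 : 57 / 400 * P * (57 / 400 * P) <= t * t by apply: Rmult_le_compat; Lra.lra.
have t3 : 57 / 400 * P * (57 / 400 * P * (57 / 400 * P)) <= t * (t * t).
  by apply: Rmult_le_compat => //; [Lra.lra|apply: Rmult_le_pos; Lra.lra|Lra.lra].
(* Here 0.0027 = 0.1452 - 0.1425. So [29 / 10 * T] is at most 0.00135 P^3, whereas
   [6 * T = t ^ 3 - t] with [t >= 57 / 400 * P] makes it exceed 0.00139 P^3. *)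
have key3 : P * (P / 2) * (t + c) <= P * (P / 2) * (27 / 10000 * P).
  by apply: Rmult_le_compat_l; [apply: Rmult_le_pos; Lra.lra|Lra.lra].
have P2 : 10000 * P <= P * P by apply: Rmult_le_compat_r; Lra.lra.
have P3 : 10000 * (P * P) <= P * (P * P).
  by apply: Rmult_le_compat_r => //; Lra.nra.
Lra.lra.
Qed.

End StdlibReals.

Section RealAnalysis.
Local Open Scope ring_scope.
Local Notation R := Rdefinitions.R.

Lemma IZR_natE k : IZR (Z.of_nat k) = k%:R :> R.
Proof. by rewrite -INR_IZR_INZ INRE. Qed.

Lemma cosRD (x y : R) : cos (x + y)%R = cos x * cos y - sin x * sin y.
Proof. exact: cos_plus. Qed.

Lemma sinRD (x y : R) : sin (x + y)%R = sin x * cos y + cos x * sin y.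
Proof. exact: sin_plus. Qed.

Lemma cos2sin2 (x : R) : cos x ^+ 2 + sin x ^+ 2 = 1.
Proof. by rewrite !expr2 addrC; exact: sin2_cos2. Qed.

Lemma sum_periodic_shift (f : nat -> R) p m : (forall x, f (x + p)%N = f x) ->
  \sum_(j < p) f (j + m)%N = \sum_(j < p) f j.
Proof.
move=> per; elim: m => [|m IHm]; first by apply: eq_bigr => j _; rewrite addn0.
case: p => [|p] in per IHm *; first by rewrite !big_ord0.
rewrite -IHm big_ord_recr big_ord_recl /= addrC; congr (_ + _).
  by rewrite addnS -addSn addnC per.
by apply: eq_bigr => j _; rewrite /bump addnS.
Qed.

Section Trig.
Variable q : nat.
Local Notation p := (2 * q).+1.

Let w : R := (PI / p%:R * 2)%R.
Definition cs (j : nat) : R := cos (w * j%:R)%R.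
Definition sn (j : nat) : R := sin (w * j%:R)%R.

Let p0 : (0 : R) < p%:R. Proof. by rewrite ltr0n. Qed.

Lemma csD i j : cs (i + j)%N = cs i * cs j - sn i * sn j.
Proof. by rewrite /cs natrD mulrDr cosRD. Qed.

Lemma snD i j : sn (i + j)%N = sn i * cs j + cs i * sn j.
Proof. by rewrite /sn natrD mulrDr sinRD. Qed.

Lemma cs2sn2 j : cs j ^+ 2 + sn j ^+ 2 = 1. Proof. exact: cos2sin2. Qed.

Lemma cs0 : cs 0 = 1. Proof. by rewrite /cs mulr0; exact: cos_0. Qed.
Lemma sn0 : sn 0 = 0. Proof. by rewrite /sn mulr0; exact: sin_0. Qed.

Lemma wp : w * p%:R = PI + PI.
Proof. by rewrite /w mulrAC divfK ?lt0r_neq0 // mulr_natr mulr2n. Qed.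

Lemma csp : cs p = 1.
Proof. by rewrite /cs wp cosRD (cos_PI : _ = -1) (sin_PI : _ = 0); ring. Qed.

Lemma snp : sn p = 0.
Proof. by rewrite /sn wp sinRD (cos_PI : _ = -1) (sin_PI : _ = 0); ring. Qed.

Lemma csperD j : cs (j + p)%N = cs j. Proof. by rewrite csD csp snp; ring. Qed.
Lemma snperD j : sn (j + p)%N = sn j. Proof. by rewrite snD csp snp; ring. Qed.

Lemma cs_perM k j : cs (j + k * p)%N = cs j.
Proof. by elim: k => [|k IHk]; rewrite ?addn0 // mulSnr addnA csperD. Qed.

Lemma sn_perM k j : sn (j + k * p)%N = sn j.
Proof. by elim: k => [|k IHk]; rewrite ?addn0 // mulSnr addnA snperD. Qed.

Lemma cs_opp k x y : (x + y)%N = (k * p)%N -> cs x = cs y.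
Proof.
move=> E; have h1 : cs y * cs x - sn y * sn x = 1 by rewrite -csD addnC E -[(k * p)%N]add0n cs_perM cs0.
have h2 : sn y * cs x + cs y * sn x = 0 by rewrite -snD addnC E -[(k * p)%N]add0n sn_perM sn0.
have h3 := cs2sn2 y.
have -> : cs x = (cs y * cs x - sn y * sn x) * cs y + (sn y * cs x + cs y * sn x) * sn y.
  by rewrite -[LHS]mul1r -h3; ring.
by rewrite h1 h2; ring.
Qed.

Lemma sn_opp k x y : (x + y)%N = (k * p)%N -> sn x = - sn y.
Proof.
move=> E; have h1 : cs y * cs x - sn y * sn x = 1 by rewrite -csD addnC E -[(k * p)%N]add0n cs_perM cs0.
have h2 : sn y * cs x + cs y * sn x = 0 by rewrite -snD addnC E -[(k * p)%N]add0n sn_perM sn0.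
have h3 := cs2sn2 y.
have -> : sn x = (sn y * cs x + cs y * sn x) * cs y - (cs y * cs x - sn y * sn x) * sn y.
  by rewrite -[LHS]mul1r -h3; ring.
by rewrite h1 h2; ring.
Qed.

Lemma sin_pos (x : R) : 0 < x -> x < PI -> 0 < sin x.
Proof. by move=> /RltP h1 /RltP h2; apply/RltP; apply: sin_gt_0. Qed.

Lemma PIgt0 : 0 < PI :> R. Proof. by apply/RltP; exact: PI_RGT_0. Qed.

Lemma sn_gt0 s : (0 < s <= q)%N -> 0 < sn s.
Proof.
move=> /andP[s0 sq]; apply: sin_pos.
  by rewrite mulr_gt0 ?ltr0n // /w mulr_gt0 // divr_gt0 ?PIgt0.
rewrite /w -mulrA -natrM mulrAC ltr_pdivrMr // ltr_pM2l ?PIgt0 // ltr_nat; lia.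
Qed.

Lemma cs_lt1 j : (0 < j < p)%N -> cs j < 1.
Proof.
move=> /andP[j0 jp].
have -> : cs j = 1 - 2 * sin (PI / p%:R * j%:R)%R ^+ 2.
  have -> : cs j = cos (PI / p%:R * j%:R + PI / p%:R * j%:R)%R by rewrite /cs /w; congr cos; ring.
  rewrite cosRD; have := cos2sin2 (PI / p%:R * j%:R)%R.
  move: (cos _) (sin _) => c s h.
  have -> : c * c = 1 - s ^+ 2 by rewrite -h; ring.
  by ring.
suff : 0 < sin (PI / p%:R * j%:R)%R ^+ 2 by lra.
rewrite exprn_gt0 // sin_pos //; first by rewrite mulr_gt0 ?ltr0n // divr_gt0 ?PIgt0.
by rewrite mulrAC ltr_pdivrMr // ltr_pM2l ?PIgt0 // ltr_nat.
Qed.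

Lemma sin_lower_nat v : (500 * v <= 73 * p)%N ->
  29 / 10 * v%:R <= p%:R * sin (PI / p%:R * v%:R)%R :> R.
Proof.
move=> vp; have e29 : IZR 29 = 29 :> R := IZR_natE 29; have e10 : IZR 10 = 10 :> R := IZR_natE 10.
have e146 : IZR 146 = 146 :> R := IZR_natE 146; have e1000 : IZR 1000 = 1000 :> R := IZR_natE 1000.
have h1 : Rle (IZR 0) v%:R by apply/RleP; rewrite ler0n.
have h2 : Rlt (IZR 0) p%:R by apply/RltP.
have h3 : Rle v%:R (Rmult (Rdiv (IZR 146) (IZR 1000)) p%:R).
  apply/RleP; rewrite e146 e1000 RdivE RmultE mulrAC ler_pdivlMr // -!natrM ler_nat.
  by move: vp; clear; lia.
have /RleP := sin_lower h1 h2 h3.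
by rewrite e29 e10 !RdivE !RmultE.
Qed.

Lemma sn_lower1 s : (500 * (2 * s) <= 73 * p)%N -> 29 / 10 * (2 * s)%:R <= p%:R * sn s.
Proof.
move=> /sin_lower_nat; rewrite /sn /w natrM => h.
by apply: le_trans h _; rewrite !mulrA.
Qed.

Lemma sn_lower2 s : (2 * s <= p)%N -> (500 * (p - 2 * s) <= 73 * p)%N ->
  29 / 10 * (p - 2 * s)%:R <= p%:R * sn s.
Proof.
move=> sp /sin_lower_nat; suff -> : sin (PI / p%:R * (p - 2 * s)%:R)%R = sn s by [].
have -> : (PI / p%:R * (p - 2 * s)%:R = PI + - (w * s%:R))%R.
  rewrite natrB // mulrBr divfK ?lt0r_neq0 // /w natrM; congr (_ - _); ring.
by rewrite sinRD (sin_PI : _ = 0) (cos_PI : _ = -1) (sin_neg : forall x, sin (- x)%R = - sin x)%R /sn; ring.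
Qed.

(** Shifting [r] by 1 rotates the vector [(X, Y)] by a nontrivial angle and leaves it unchanged, so
    it vanishes. *)
Lemma sum_cs_mul m : ~~ (p %| m)%N -> \sum_(r < p) cs (r * m) = 0.
Proof.
move=> pm.
pose X : R := \sum_(r < p) cs (r * m); pose Y : R := \sum_(r < p) sn (r * m).
have hX : X = cs m * X - sn m * Y.
  rewrite {1}/X -(@sum_periodic_shift (fun r => cs (r * m)) p 1); last first.
    by move=> x; rewrite mulnDl mulnC (mulnC p) mulnC cs_perM.
  rewrite /X /Y !mulr_sumr -sumrB; apply: eq_bigr => r _.
  by rewrite mulnDl mul1n csD; ring.
have hY : Y = cs m * Y + sn m * X.
  rewrite {1}/Y -(@sum_periodic_shift (fun r => sn (r * m)) p 1); last first.
    by move=> x; rewrite mulnDl mulnC (mulnC p) mulnC sn_perM.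
  rewrite /X /Y !mulr_sumr -big_split; apply: eq_bigr => r _.
  by rewrite /= mulnDl mul1n snD; ring.
have cm : cs m < 1.
  rewrite (divn_eq m p) addnC cs_perM; apply: cs_lt1.
  by rewrite ltn_mod andbT lt0n.
have : X * (2 * (1 - cs m)) = 0.
  have h := cs2sn2 m.
  have e1 : X * (1 - cs m) = - sn m * Y by rewrite mulrBr mulr1 {1}hX; ring.
  have e2 : Y * (1 - cs m) = sn m * X by rewrite mulrBr mulr1 {1}hY; ring.
  have e3 : X * (1 - cs m) * (1 - cs m) = - sn m ^+ 2 * X.
    by rewrite e1 -mulrA e2; ring.
  have -> : X * (2 * (1 - cs m)) = X * (1 - cs m) * (1 - cs m) + X * (1 - cs m ^+ 2) by ring.
  have -> : 1 - cs m ^+ 2 = sn m ^+ 2 by rewrite -h; ring.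
  by rewrite e3; ring.
move/eqP; rewrite mulf_eq0 => /orP[/eqP //|/eqP]; lra.
Qed.

Lemma sum_cs_mul0 m : (p %| m)%N -> \sum_(r < p) cs (r * m) = p%:R.
Proof.
move=> /dvdnP[k ->]; rewrite (eq_bigr (fun _ => 1)); first by rewrite sumr_const card_ord.
by move=> r _; rewrite mulnA -[(_ * _)%N]add0n cs_perM cs0.
Qed.

(** * Fourier coefficients of a sum-free set *)

Section Sets.
Variable a : pred nat.
Hypothesis per : forall x, a (x + p)%N = a x.
Hypothesis sf : forall x y, a x -> a y -> ~~ a (x + y)%N.

Let ar (j : nat) : R := (a j)%:R.
Let n := (\sum_(i < p) a i)%N.
Let CA r : R := \sum_(j < p) ar j * cs (r * j).
Let SA r : R := \sum_(j < p) ar j * sn (r * j).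

Lemma sum_ar : \sum_(j < p) ar j = n%:R.
Proof. by rewrite /n natr_sum. Qed.

Lemma norm2_fourier r : CA r ^+ 2 + SA r ^+ 2 =
  \sum_(i < p) \sum_(j < p) ar i * ar j * cs (r * (i + (p - j))).
Proof.
rewrite !expr2 /CA /SA !mulr_suml -big_split; apply: eq_bigr => i _ /=.
rewrite !mulr_sumr -big_split; apply: eq_bigr => j _ /=.
have jp : (j <= p)%N by rewrite ltnW.
have E : (r * (p - j) + r * j = r * p)%N by rewrite -mulnDr subnK.
by rewrite mulnDr csD (cs_opp E) (sn_opp E); ring.
Qed.

Lemma sum_norm : \sum_(r < p) (CA r ^+ 2 + SA r ^+ 2) = p%:R * n%:R.
Proof.
under eq_bigr => r _ do rewrite norm2_fourier.
rewrite exchange_big /= -sum_ar mulr_sumr.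
apply: eq_bigr => i _; rewrite exchange_big /= (bigD1 i) //= [X in _ + X]big1 ?addr0.
  rewrite -mulr_sumr sum_cs_mul0; first by rewrite /ar; case: (a i); rewrite ?mul1r ?mul0r ?mulr1 ?mulr0.
  by rewrite subnKC // ltnW.
move=> j ji; rewrite -mulr_sumr sum_cs_mul ?mulr0 //.
apply: contra ji => /dvdnP[k E]; apply/eqP/val_inj => /=.
have ip := ltn_ord i; have jp := ltn_ord j.
case: k => [|[|k]] in E; [lia|lia|].
have : (2 * p <= k.+2 * p)%N by rewrite leq_mul2r orbT.
lia.
Qed.

(** Up to a factor, orthogonality turns the sum into a count of solutions of [i + l = j] and
    [j + l = i] modulo [p]; the real part [CA] brings in both signs of [l]. *)
Lemma sum_norm_CA : \sum_(r < p) (CA r ^+ 2 + SA r ^+ 2) * CA r = 0.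
Proof.
have -> : \sum_(r < p) (CA r ^+ 2 + SA r ^+ 2) * CA r =
   \sum_(r < p) \sum_(i < p) \sum_(j < p) \sum_(l < p)
     (ar i * ar j * ar l / 2) * (cs (r * (i + (p - j) + l)) + cs (r * (i + (p - j) + (p - l)))).
  apply: eq_bigr => r _; rewrite norm2_fourier mulr_suml; apply: eq_bigr => i _.
  rewrite mulr_suml; apply: eq_bigr => j _; rewrite /CA mulr_sumr; apply: eq_bigr => l _.
  have E : (r * (p - l) + r * l = r * p)%N by rewrite -mulnDr subnK // ltnW.
  rewrite !(mulnDr r (i + (p - j))%N) (csD (r * (i + (p - j)))%N) (csD (r * (i + (p - j)))%N (r * (p - l))%N).
  rewrite (cs_opp E) (sn_opp E); by field.
rewrite exchange_big; apply: big1 => i _; rewrite exchange_big; apply: big1 => j _.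
rewrite exchange_big; apply: big1 => l _; rewrite -mulr_sumr big_split /=.
case ai : (a i); last by rewrite /ar ai !mul0r.
case aj : (a j); last by rewrite /ar aj mulr0 !mul0r.
case al : (a l); last by rewrite /ar al mulr0 !mul0r.
have jp := ltnW (ltn_ord j); have lp := ltnW (ltn_ord l).
rewrite !sum_cs_mul ?addr0 ?mulr0 //.
  apply/negP=> /dvdnP[k E]; have := sf aj al.
  suff -> : a (j + l)%N = a i by rewrite ai.
  by rewrite -(periodic_addM per (j + l)%N k) -E -(periodic_addM per i 2); congr (a _); lia.
apply/negP=> /dvdnP[k E]; have := sf ai al.
suff -> : a (i + l)%N = a j by rewrite aj.
by rewrite -(periodic_addM per j k) -E -per; congr (a _); lia.
Qed.

Lemma sum_free_0 : a 0 = false.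
Proof. by apply/negP=> a0; have := sf a0 a0; rewrite addn0 a0. Qed.

Lemma sum_free_lt : (n < p)%N.
Proof.
rewrite /n big_ord_recl sum_free_0 add0n ltnS /=.
by apply: (sum_le1 (f := fun i => a (bump 0 i))) => i _; case: (a _).
Qed.

Lemma CA0 : CA 0 = n%:R.
Proof. by rewrite -sum_ar; apply: eq_bigr => j _; rewrite mul0n cs0 mulr1. Qed.

Lemma SA0 : SA 0 = 0.
Proof. by apply: big1 => j _; rewrite mul0n sn0 mulr0. Qed.

(** By Parseval ([sum_norm]) and [sum_norm_CA], the values of [F] at nonzero [r] add up to 0. If the
    linear factor of [F] were positive at all of them, all nontrivial coefficients would vanish,
    against Parseval for [0 < n < p]. Replacing [r] by [p - r] conjugates the coefficient, which
    gives the sign of [SA r]. *)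
Lemma fourier_coef : (0 < n)%N ->
  exists r, [/\ (0 < r < p)%N, CA r * (p - n)%:R <= - n%:R ^+ 2 & 0 <= SA r].
Proof.
move=> n0.
suff [r rp hr] : exists2 r, (0 < r < p)%N & CA r * (p - n)%:R <= - n%:R ^+ 2.
  have [sr|/ltW sr] := leP 0 (SA r); first by exists r.
  have /andP[r0 rp'] := rp.
  exists (p - r)%N; split; first by lia.
    suff -> : CA (p - r)%N = CA r by [].
    apply: eq_bigr => j _; congr (_ * _); apply: (@cs_opp j).
    by rewrite -mulnDl subnK ?(ltnW rp') // mulnC.
  suff -> : SA (p - r)%N = - SA r by rewrite oppr_ge0.
  rewrite /SA -sumrN; apply: eq_bigr => j _; rewrite -mulrN; congr (_ * _).
  by apply: (@sn_opp j); rewrite -mulnDl subnK ?(ltnW rp') // mulnC.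
pose F (r : nat) := (CA r ^+ 2 + SA r ^+ 2) * (CA r * (p - n)%:R + n%:R ^+ 2).
have pn : (p - n)%:R = p%:R - n%:R :> R by rewrite natrB // ltnW // sum_free_lt.
have sF : \sum_(i < 2 * q) F i.+1 = 0.
  have : \sum_(r < p) F r = n%:R ^+ 2 * (p%:R * n%:R).
    have -> : \sum_(r < p) F r = (\sum_(r < p) (CA r ^+ 2 + SA r ^+ 2) * CA r) * (p - n)%:R +
       (\sum_(r < p) (CA r ^+ 2 + SA r ^+ 2)) * n%:R ^+ 2.
      by rewrite !mulr_suml -big_split; apply: eq_bigr => r _; rewrite /F /=; ring.
    by rewrite sum_norm_CA sum_norm; ring.
  rewrite big_ord_recl {1}/F CA0 SA0 pn => h.
  have {}h := canRL (addKr _) h; rewrite (eq_bigr (fun i : 'I_(2 * q) => F i.+1)) // in h.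
  by rewrite h; ring.
have [|none] := boolP [exists r : 'I_(2 * q), CA r.+1 * (p - n)%:R <= - n%:R ^+ 2].
  by move=> /existsP[r hr]; exists r.+1; first exact: ltn_ord r.
have pos (r : 'I_(2 * q)) : 0 < CA r.+1 * (p - n)%:R + n%:R ^+ 2.
  by move: none; rewrite negb_exists => /forallP/(_ r); rewrite -ltNge; lra.
have nn r : 0 <= CA r ^+ 2 + SA r ^+ 2 by rewrite addr_ge0 // sqr_ge0.
have Fnn (r : 'I_(2 * q)) : true -> 0 <= F r.+1 by move=> _; rewrite mulr_ge0 // ltW.
have F0 := psumr_eq0P Fnn sF.
have := sum_norm; rewrite big_ord_recl CA0 SA0 big1.
  move=> h; exfalso.
  have : n%:R * (p%:R - n%:R) = 0 :> R by move: h; rewrite expr0n /= => h; have := h; lra.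
  move/eqP; rewrite -pn -natrM pnatr_eq0 muln_eq0; have := sum_free_lt; lia.
move=> r _; have /eqP := F0 r isT; rewrite /F mulf_eq0 (gt_eqF (pos r)) orbF => /eqP.
by [].
Qed.

End Sets.

End Trig.

Lemma sum_fold (V : nmodType) (q : nat) (f : nat -> V) :
  \sum_(i < (2 * q).+1) f i =
    f 0%N + \sum_(i < q) f i.+1 + \sum_(i < q) f ((2 * q).+1 - i.+1)%N.
Proof.
rewrite big_ord_recl /= -addrA; congr (_ + _).
have -> : \sum_(i < 2 * q) f (bump 0 i) = \sum_(i < q + q) f i.+1 by rewrite addnn -mul2n.
rewrite big_split_ord /=; congr (_ + _).
rewrite (reindex_inj rev_ord_inj) /=; apply: eq_bigr => i _; congr f.
by move: (ltn_ord i); lia.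
Qed.

(** As [p = 2 * q + 1] is odd, each nonzero residue is [2 * s] or [p - 2 * s] for one [s] in
    [[1, q]]; these are the lengths of the two arcs between [s] and [-s]. *)
Lemma sum_parity (q : nat) (f : nat -> nat) :
  (\sum_(i < (2 * q).+1) f i =
    f 0 + \sum_(i < q) (f (2 * i.+1) + f ((2 * q).+1 - 2 * i.+1)))%N.
Proof.
rewrite big_split /= addnA.
have -> : (\sum_(i < q) f ((2 * q).+1 - 2 * i.+1) = \sum_(i < q) f (2 * i).+1)%N.
  rewrite [RHS](reindex_inj rev_ord_inj) /=; apply: eq_bigr => i _; congr f.
  by move: (ltn_ord i); lia.
elim: q => [|q IHq]; first by rewrite muln0 !big_ord0 big_ord1 !addn0.
have -> : (2 * q.+1).+1 = (2 * q).+3 by lia.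
have e : (2 * q.+1 = (2 * q).+2)%N by lia.
have eA : (\sum_(i < q.+1) f (2 * i.+1) = \sum_(i < q) f (2 * i.+1) + f (2 * q).+2)%N.
  by rewrite big_ord_recr /= e.
rewrite 2!big_ord_recr /= IHq eA (big_ord_recr q).
rewrite /=; move: (f 0%N) (f (2 * q).+1) (f (2 * q).+2) (\sum_(i < q) f (2 * i.+1))%N.
move: (\sum_(i < q) f (2 * i).+1)%N; clear; lia.
Qed.

Lemma sum_pyramid t m : (t <= m)%N -> (6 * (\sum_(v < m) (t - v) * v) + t = t ^ 3)%N.
Proof.
move=> tm; have {m tm}-> : (\sum_(v < m) (t - v) * v = \sum_(v < t) (t - v) * v)%N.
  rewrite -(subnKC tm) big_split_ord /= [X in (_ + X)%N]big1 ?addn0 //.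
  by move=> i _; rewrite subnDA subnn sub0n.
elim: t => [|t IHt]; first by rewrite big_ord0.
have -> : (\sum_(v < t.+1) (t.+1 - v) * v = \sum_(v < t) (t - v) * v + \sum_(v < t.+1) v)%N.
  rewrite !big_ord_recr /= subSnn mul1n addnA -big_split /=; congr (_ + _)%N.
  by apply: eq_bigr => v _; rewrite subSn 1?ltnW // mulSnr.
have h : (2 * (\sum_(v < t.+1) v) = t * t.+1)%N.
  elim: t {IHt} => [|t IHt]; first by rewrite big_ord1.
  by rewrite big_ord_recr mulnDr IHt /=; lia.
move: IHt h; set s1 := (\sum_(v < t) _)%N; set s2 := (\sum_(v < t.+1) _)%N.
rewrite !expnS expn0; move: s1 s2 => s1 s2; nia.
Qed.

Lemma sum_dilate (p r : nat) (f : nat -> R) : coprime r p -> (0 < r)%N -> (0 < p)%N ->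
  (forall x, f (x + p)%N = f x) -> \sum_(j < p) f (r * j)%N = \sum_(j < p) f j.
Proof.
move=> cop r0 p0 per.
have periodic_addM x k : f (x + k * p)%N = f x.
  by elim: k => [|k IHk]; rewrite ?addn0 // mulSnr addnA per.
have [[u v] /= uv] := coprimeP _ r0 cop.
have uv' : (u * r = 1 + v * p)%N by lia.
pose h (j : 'I_p) := Ordinal (ltn_pmod (r * j) p0).
have inj : injective h.
  move=> i j /(congr1 val) /= E; apply: val_inj.
  have : (u * (r * i) = u * (r * j) %[mod p])%N by rewrite -modnMmr E modnMmr.
  have e (x : nat) : (u * (r * x) = v * x * p + x)%N by rewrite mulnA uv' mulnDl mul1n addnC mulnAC.
  by rewrite !e !modnMDl !modn_small.
rewrite [RHS](reindex_inj inj); apply: eq_bigr => j _ /=.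
by rewrite {1}(divn_eq (r * j) p) addnC periodic_addM.
Qed.

(** * Half-arc counts and the first Fourier coefficient *)

Section HalfArc.
Variables (q : nat) (b : pred nat) (k : nat).
Local Notation p := (2 * q).+1.
Hypothesis q0 : (0 < q)%N.
Hypothesis per : forall x, b (x + p)%N = b x.
Let n := (\sum_(i < p) b i)%N.
Let h s := (\sum_(i < q.+1) b (s + i)%N)%N.
Hypothesis hk : forall s, (h s <= k)%N.
Let t := (2 * k - n)%N.
Hypothesis t2 : (500 * t <= 73 * p)%N.

Lemma half_arc_step s : (h s.+1 + b s = h s + b (s + q.+1))%N.
Proof.
rewrite /h big_ord_recr [in RHS]big_ord_recl /= addn0 addSn addnS.
have -> : (\sum_(i < q) b (s.+1 + i) = \sum_(i < q) b (s + bump 0 i))%N.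
  by apply: eq_bigr => i _; rewrite addSn -addnS.
by rewrite addnC addnA.
Qed.

Lemma half_arc_lip s m : (h s <= h (s + m) + m)%N /\ (h (s + m) <= h s + m)%N.
Proof.
elim: m => [|m [IH1 IH2]]; first by rewrite !addn0.
rewrite (addnS s); have := half_arc_step (s + m).
move: (b (s + m)%N) (b (s + m + q.+1)%N) (h (s + m).+1) (h (s + m)%N) (h s) IH1 IH2.
by clear; move=> [] [] x y z /=; lia.
Qed.

Lemma half_arc_periodic s : h (s + p) = h s.
Proof. by apply: eq_bigr => i _; rewrite addnAC per. Qed.

(** The complement of a half-arc lies in the half-arc starting at [s + q.+1]. *)
Lemma half_arc_compl s : (n <= h s + k)%N.
Proof.
have -> : n = (\sum_(i < p) b (i + s)%N)%N.
  rewrite /n; elim: s => [|s ->]; first by apply: eq_bigr => i _; rewrite addn0.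
  rewrite big_ord_recl [in RHS]big_ord_recr /= addnC; congr (_ + _)%N.
    by apply: eq_bigr => i _; rewrite /bump addnS.
  by rewrite add0n -addSnnS addnC per.
have -> : (\sum_(i < p) b (i + s)%N = \sum_(i < q.+1 + q) b (s + i)%N)%N.
  have -> : (q.+1 + q = p)%N by lia.
  by apply: eq_bigr => i _; rewrite addnC.
rewrite big_split_ord leq_add2l; apply: leq_trans (hk (s + q.+1)%N).
rewrite /h big_ord_recr /=; apply: leq_trans (leq_addr _ _).
by apply: leq_sum => i _; rewrite addnA.
Qed.

Let Z : R := \sum_(s < q) sn q s.+1.
Let br (j : nat) : R := (b j)%:R.
Let CB : R := \sum_(j < p) br j * cs q j.
Let SB : R := \sum_(j < p) br j * sn q j.

Lemma modulus_gt1 : (1 < p)%N. Proof. lia. Qed.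

Lemma half_cs : \sum_(i < q.+1) cs q i = 1 / 2.
Proof.
have := @sum_cs_mul q 1%N; rewrite dvdn1 neq_ltn modulus_gt1 orbT => /(_ isT).
under eq_bigr => r _ do rewrite muln1.
rewrite sum_fold cs0.
have -> : \sum_(i < q) cs q (p - i.+1) = \sum_(i < q) cs q i.+1.
  apply: eq_bigr => i _; apply: (@cs_opp q 1%N).
  by move: (ltn_ord i); lia.
by rewrite big_ord_recl /= cs0; under [in X in _ -> X]eq_bigr => i _ do rewrite /bump add1n; lra.
Qed.

Lemma half_sn : \sum_(i < q.+1) sn q i = Z.
Proof. by rewrite big_ord_recl /= sn0 add0r. Qed.

(* Counting points in half-arcs is convolving with the indicator of a half-arc, whose first Fourier
   coefficient has real part 1 / 2 and, up to sign, imaginary part Z. *)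
Lemma half_arc_sum_eq : \sum_(s < p) (h s)%:R * sn q s = SB / 2 - Z * CB.
Proof.
have -> : \sum_(s < p) (h s)%:R * sn q s = \sum_(i < q.+1) \sum_(j < p) br j * sn q (j + (p - i)).
  have -> : \sum_(s < p) (h s)%:R * sn q s = \sum_(s < p) \sum_(i < q.+1) br (s + i) * sn q s.
    by apply: eq_bigr => s _; rewrite /h natr_sum mulr_suml.
  rewrite exchange_big; apply: eq_bigr => i _ /=.
  rewrite -(@sum_periodic_shift (fun j => br j * sn q (j + (p - i))) p i); last first.
    by move=> x; rewrite /br per addnAC snperD.
  apply: eq_bigr => s _; congr (_ * _).
  by rewrite -addnA subnKC ?snperD //; move: (ltn_ord i); lia.
rewrite exchange_big /= -half_sn /SB /CB mulr_suml mulr_sumr -sumrB.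
apply: eq_bigr => j _.
have E (i : 'I_q.+1) : sn q (j + (p - i)) = sn q j * cs q i - cs q j * sn q i.
  have Ei : (p - i + i = 1 * p)%N by move: (ltn_ord i); lia.
  by rewrite snD // (cs_opp Ei) (sn_opp Ei); ring.
under eq_bigr => i _ do rewrite E.
rewrite -mulr_sumr sumrB -!mulr_sumr half_cs; ring.
Qed.

Lemma half_arc_sum_fold : \sum_(s < p) (h s)%:R * sn q s =
  \sum_(i < q) ((h i.+1)%:R - (h (p - i.+1))%:R) * sn q i.+1.
Proof.
rewrite (sum_fold q (fun s => (h s)%:R * sn q s)) sn0 mulr0 add0r -big_split; apply: eq_bigr => i _ /=.
have Ei : (p - i.+1 + i.+1 = 1 * p)%N by move: (ltn_ord i); lia.
by rewrite (sn_opp Ei); ring.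
Qed.

(** The arcs between [-s] and [s] have lengths [2 * s] and [p - 2 * s], so [h s - h (p - s)] is at
    most each of these and at most [t]; the minimum of the three is [t - u - v]. A nonzero [u] or
    [v] occurs only where the linear lower bounds for [sn q s] hold, and [sum_parity] collects these
    savings into one sum. *)
Lemma half_arc_sum_le : p%:R * (SB / 2 - Z * CB) <=
  p%:R * (t%:R * Z) - 29 / 10 * (\sum_(v < p) (t - v) * v)%:R.
Proof.
rewrite -half_arc_sum_eq half_arc_sum_fold (sum_parity q (fun v => (t - v) * v)%N) /= muln0 add0n.
rewrite natr_sum /Z !mulr_sumr -sumrB; apply: ler_sum => i _.
have iq := ltn_ord i; pose s := i.+1; rewrite -/s.
have s0 : 0 < sn q s by apply: sn_gt0; rewrite // ltnS.
set u := (t - 2 * s)%N; set v := (t - (p - 2 * s))%N.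
have hN : (h s + u + v <= h (p - s) + t)%N.
  have [_ l1] := half_arc_lip (p - s) (2 * s); have [l2 _] := half_arc_lip s (p - 2 * s).
  have e1 : (p - s + 2 * s = s + p)%N by rewrite /s; lia.
  have e2 : (s + (p - 2 * s) = p - s)%N by rewrite /s; lia.
  rewrite e1 half_arc_periodic in l1; rewrite e2 in l2.
  have := half_arc_compl (p - s); have := hk s; move: t2 l1 l2.
  rewrite /u /v /t /s; move: (h _) (h _) n => h1 h2 n'; move: iq; clear; lia.
have hR : (h s)%:R - (h (p - s))%:R <= t%:R - u%:R - v%:R :> R.
  by move: hN; rewrite -(ler_nat R) !natrD; lra.
have h1 : 29 / 10 * (u * (2 * s))%:R <= p%:R * sn q s * u%:R.
  case: (posnP u) => [->|u0]; first by rewrite mul0n !mulr0.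
  rewrite natrM (mulrC u%:R) mulrA ler_wpM2r ?ler0n //; apply: sn_lower1.
  by move: u0 t2; rewrite /u; clear; lia.
have h2 : 29 / 10 * (v * (p - 2 * s))%:R <= p%:R * sn q s * v%:R.
  case: (posnP v) => [->|v0]; first by rewrite mul0n !mulr0.
  rewrite natrM (mulrC v%:R) mulrA ler_wpM2r ?ler0n //; apply: sn_lower2.
    by move: iq; rewrite /s; clear; lia.
  by move: v0 t2; rewrite /v; clear; lia.
rewrite natrD mulrDr.
have p0 : 0 < p%:R :> R by rewrite ltr0n.
have := ler_wpM2r (ltW s0) hR; rewrite -(ler_pM2l p0).
move: h1 h2; move: (sn q s) => x; lra.
Qed.

Lemma sum_sn_bounds : 0 < Z /\ 2 * Z <= p%:R.
Proof.
split.
  rewrite /Z; have pos := @sn_gt0 q.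
  have : forall i : 'I_q, 0 < sn q i.+1 by move=> i; apply: pos; exact: ltn_ord i.
  move=> posi; rewrite (bigD1 (Ordinal q0)) //= ltr_wpDr ?posi //; last exact: (posi (Ordinal q0)).
  by apply: sumr_ge0 => i _; rewrite ltW.
have : Z <= \sum_(s < q) 1.
  apply: ler_sum => i _; have := cs2sn2 q i.+1; have := sqr_ge0 (cs q i.+1); nra.
rewrite sumr_const card_ord => hZ.
have : p%:R = 2 * q%:R + 1 :> R by rewrite -natr1 natrM.
by move: hZ; lra.
Qed.

Lemma half_arc_dense : (14 * 1000 <= p)%N -> (313 * p <= 1000 * n)%N -> (3 * k <= p + 3 - n)%N ->
  0 <= SB -> CB * (p - n)%:R <= - n%:R ^+ 2 -> (n < p)%N -> False.
Proof.
move=> pbig nbig kbig SB0 CBn np.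
have [Z0 Zp] := sum_sn_bounds; have V := half_arc_sum_le.
set T := (\sum_(v < p) _)%N in V.
have TE : (6 * T + t = t ^ 3)%N by apply: sum_pyramid; move: t2; clear; lia.
have nR : (p - n)%:R = p%:R - n%:R :> R by rewrite natrB // ltnW.
have n2k : (n <= 2 * k)%N by apply: leq_trans (half_arc_compl 0) _; rewrite mul2n -addnn leq_add2r.
have e2 : IZR 2 = 2 :> R := IZR_natE 2; have e29 : IZR 29 = 29 :> R := IZR_natE 29.
have e10 : IZR 10 = 10 :> R := IZR_natE 10; have e6 : IZR 6 = 6 :> R := IZR_natE 6.
have e3 : IZR 3 = 3 :> R := IZR_natE 3; have e5 : IZR 5 = 5 :> R := IZR_natE 5.
have e313 : IZR 313 = 313 :> R := IZR_natE 313; have e1000 : IZR 1000 = 1000 :> R := IZR_natE 1000.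
have e10000 : IZR 10000 = 10000%N%:R :> R := IZR_natE 10000.
apply: (@half_arc_numeric T%:R t%:R n%:R p%:R CB Z SB).
- by apply/RleP; rewrite !RdivE e2 e29 e10.
- rewrite e6 !RplusE !RmultE; by rewrite -!natrM -natrD TE !expnS muln1.
- by apply/RleP; exact: ler0n.
- by apply/RleP; exact: ler0n.
- apply/RleP; rewrite e3 e5 e2 e6 !RplusE !RmultE.
  by rewrite -!natrM -!natrD ler_nat /t; move: kbig n2k np; clear; move: (n) => m; lia.
- by apply/RleP; rewrite e313 e1000 !RmultE -!natrM ler_nat.
- by apply/RleP; rewrite e10000 ler_nat (leq_trans _ pbig).
- by apply/RltP; rewrite ltr_nat.
- by apply/RleP; move: CBn; rewrite nR expr2.
- by apply/RleP; rewrite e2.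
- exact/RltP.
- exact/RleP.
Qed.

End HalfArc.

End RealAnalysis.

(** * Conclusion *)

Section Main.
Variables (q : nat) (a : pred nat).
Local Notation p := (2 * q).+1.
Hypothesis pp : prime p.
Hypothesis pbig : 14 * 1000 <= p.
Hypothesis per : forall x, a (x + p) = a x.
Hypothesis sf : forall x y, a x -> a y -> ~~ a (x + y).
Let n := \sum_(i < p) a i.
Hypothesis nbig : 313 * p <= 1000 * n.

Let q0 : 0 < q. Proof. by move: pbig; clear; lia. Qed.

Lemma dilate_per c x : a (c * (x + p)) = a (c * x).
Proof. by rewrite mulnDr (periodic_addM per). Qed.

Lemma dilate_sf c x y : a (c * x) -> a (c * y) -> ~~ a (c * (x + y)).
Proof. by rewrite mulnDr; apply: sf. Qed.

Lemma dilate_card c : 0 < c -> coprime c p -> \sum_(i < p) a (c * i) = n.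
Proof.
move=> c0 cop; have := @sum_dilate p c (fun j => (a j)%:R%R) cop c0 isT.
move=> /(_ _); rewrite -!natr_sum => h.
by apply/eqP; rewrite -(eqr_nat Rdefinitions.R); apply/eqP/h => x; rewrite per.
Qed.

Lemma dense_half_arc : exists c s, [/\ 0 < c, coprime c p & p + 4 <= n + 3 * \sum_(i < q.+1) a (c * (s + i))].
Proof.
have n0 : 0 < n by move: nbig pbig; clear; lia.
have np : n < p := @sum_free_lt q a sf.
have [r [/andP[r0 rp] hC hS]] := fourier_coef per sf n0.
have rcop : coprime r p by rewrite coprime_sym prime_coprime // gtnNdvd.
(* With [c] inverse to [r], the predicate [a (c * x)] describes the dilate by [r], whose first
   Fourier coefficient is the [r]-th one of [a]. *)
have [[c v] /= cv] := coprimeP _ r0 rcop.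
have cE : c * r = 1 + v * p by move: cv; clear; lia.
have c0 : 0 < c by case: c cE {cv} => //; rewrite mul0n.
have ccop : coprime c p.
  by apply/(coprimeP _ c0); exists (r, v); rewrite /= mulnC cE addnK.
pose h s := \sum_(i < q.+1) a (c * (s + i)).
have [big|small] := boolP [exists s : 'I_p, p + 4 <= n + 3 * h s].
  by have /existsP[s hs] := big; exists c, s.
exfalso.
have hmod s : h s = h (s %% p).
  by apply: eq_bigr => i _; rewrite {1}(divn_eq s p) -addnA addnC mulnDr mulnA (periodic_addM per).
(* The largest half-arc count [k] with [3 * k < p + 4 - n]. *)
pose k := (p + 3 - n) %/ 3.
have hk s : h s <= k.
  move: small; rewrite negb_exists => /forallP/(_ (Ordinal (ltn_pmod s (isT : 0 < p)))).
  rewrite /= -hmod /k leq_divRL //; move: (h s) np; clear; lia.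
have bn := dilate_card c0 ccop.
have t2 : 500 * (2 * k - \sum_(i < p) a (c * i)) <= 73 * p.
  by rewrite bn /k; move: np nbig pbig; clear; lia.
have cr j : a (c * (r * j)) = a j.
  by rewrite mulnA cE mulnDl mul1n mulnAC (periodic_addM per).
have perR (f : nat -> Rdefinitions.R) x : (forall y, f (y + p) = f y) ->
    ((a (c * (x + p)))%:R * f (x + p) = (a (c * x))%:R * f x)%R.
  by move=> hf; rewrite hf dilate_per.
apply: (@half_arc_dense q (fun x => a (c * x)) k q0 (dilate_per c) hk t2 pbig).
- by rewrite bn.
- by rewrite bn /k mulnC leq_divM.
- rewrite -(@sum_dilate p r _ rcop r0 isT (fun x => perR (sn q) x (@snperD q))).
  by under eq_bigr => j _ do rewrite cr.
- rewrite bn -(@sum_dilate p r _ rcop r0 isT (fun x => perR (cs q) x (@csperD q))).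
  by under eq_bigr => j _ do rewrite cr.
- by rewrite bn.
Qed.

(** The half-arc is chosen to end at [p - k], the last possible point; only points of
    [[k, p - k - q)] can escape it. *)
Lemma support_window (b : pred nat) k : 0 < k -> k <= q.+1 ->
  (forall y, y < p -> b y -> k <= y /\ y + k <= p) ->
  \sum_(i < p) b i <= \sum_(i < q.+1) b (p - k - q + i) + (p - 2 * k - q).
Proof.
move=> k0 kq sup.
have -> : \sum_(i < p) b i = \sum_(i < p - k - q + q.+1 + k.-1) b i.
  by have -> : p - k - q + q.+1 + k.-1 = p by move: k0 kq; clear; lia.
rewrite !(sum_shift b) [X in _ + X]big1 ?addn0 => [|i _]; last first.
  case bi : (b _) => //.
  have [|_] := sup _ _ bi; have := ltn_ord i; move: k0 kq; clear; lia.
rewrite addnC leq_add2l.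
apply: leq_trans (_ : \sum_(i < p - 2 * k - q) xpredT (i : nat) <= _); last first.
  by rewrite sum1_card card_ord.
apply: (@leq_sum_inj _ _ b xpredT (fun i => i - k)) => [i iq bi|i j iq jq bi bj].
  have ip : i < p by move: iq k0; clear; lia.
  by have [ki _] := sup i ip bi; split=> //; move: iq ki; clear; lia.
have ip : i < p by move: iq k0; clear; lia.
have jp : j < p by move: jq k0; clear; lia.
have [ki _] := sup i ip bi; have [kj _] := sup j jp bj.
by move: ki kj; clear; lia.
Qed.

Lemma dilation_exists : exists c, [/\ 0 < c, coprime c p &
  forall y, y < p -> a (c * y) -> n <= y /\ y + n <= p].
Proof.
have next c s k : 0 < c -> coprime c p -> \sum_(i < q.+1) a (c * (s + i)) = k -> p + 4 <= n + 3 * k ->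
    exists c', [/\ 0 < c', coprime c' p & forall y, y < p -> a (c' * y) -> k <= y /\ y + k <= p].
  move=> c0 cc kE kb.
  have [|d [/andP[d0 dp] hd]] := @half_arc_dilation q (fun x => a (c * x)) (dilate_per c) (@dilate_sf c) s k kE.
    by rewrite dilate_card.
  exists (c * d); split; first by rewrite muln_gt0 c0.
    by rewrite coprimeMl cc coprime_sym prime_coprime // gtnNdvd.
  by move=> y yp; rewrite -mulnA => /hd; apply.
have kle c s : \sum_(i < q.+1) a (c * (s + i)) <= q.+1.
  by apply: (sum_le1 (f := fun i => a (c * (s + i)))) => i _; case: (a _).
have np : n < p := @sum_free_lt q a sf.
have [c1 [s1 [c10 c1c k1b]]] := dense_half_arc.
have k1q := kle c1 s1; set k1 := \sum_(i < _) _ in k1b k1q.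
have [c2 [c20 c2c h2]] := next c1 s1 k1 c10 c1c (erefl _) k1b.
have k10 : 0 < k1 by move: k1b np; clear; lia.
have := support_window k10 k1q h2; rewrite dilate_card //.
set k2 := \sum_(i < _) _ => n2.
have k2q : k2 <= q.+1 := kle c2 _.
(* From [n2] and [k1b], [k2] exceeds [n / 3 + p / 6], which is more than 0.27 p. Being above
   [p / 4], it makes [[k2, p - k2]] fit into a half-arc, so the next window contains the whole
   dilate. *)
have k2b : p + 4 <= n + 3 * k2 by move: k1b k1q n2 nbig pbig np; clear; lia.
have k2p : p < 4 * k2 by move: k1b k1q n2 nbig pbig np; clear; lia.
have [c3 [c30 c3c h3]] := next c2 _ k2 c20 c2c (erefl _) k2b.
have k20 : 0 < k2 by move: k2p; clear; lia.
have := support_window k20 k2q h3; rewrite dilate_card //.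
have -> : p - 2 * k2 - q = 0 by move: k2p; clear; lia.
rewrite addn0; set k3 := \sum_(i < _) _ => n3.
have k3b : p + 4 <= n + 3 * k3 by move: n3 nbig pbig; clear; lia.
have [c4 [c40 c4c h4]] := next c3 _ k3 c30 c3c (erefl _) k3b.
exists c4; split=> // y yp /(h4 y yp) []; move: n3; clear; lia.
Qed.

End Main.

Theorem theorem3p4 (p : nat) (A : {set 'I_p}) :
  prime p -> 14000 <= p -> sum_free A -> 313 * p <= 1000 * #|A| ->
  exists m : nat, [/\ 1 <= m <= p - 1 &
    forall x : 'I_p, x \in A -> #|A| <= (m * x) %% p <= p - #|A| ].
Proof.
move=> pp; rewrite (_ : 14000 = 14 * 1000) // => pbig.
have [q pE] : exists q, p = (2 * q).+1.
  exists p./2; have := odd_double_half p.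
  by have [p2|->] := even_prime pp; [rewrite p2 in pbig|rewrite -mul2n].
move: A; rewrite {}pE in pp pbig *; set P := (2 * q).+1 in pp pbig * => A sfA nbig.
pose a x := (inord (x %% P) : 'I_P) \in A.
have P0 : 0 < P by [].
have per x : a (x + P) = a x by rewrite /a modnDr.
have sf x y : a x -> a y -> ~~ a (x + y).
  move=> ax ay; apply/negP=> az; have := sfA _ _ _ ax ay az.
  by rewrite !inordK ?ltn_mod // modnDm.
have aE (x : 'I_P) : a x = (x \in A).
  by rewrite /a modn_small // inord_val.
have nE : \sum_(i < P) a i = #|A|.
  by rewrite sum_pred_card; apply: eq_card => x; rewrite inE aE.
have [|c [c0 cc hc]] := dilation_exists pp pbig per sf; first by rewrite nE.
rewrite nE in hc.
(* Since [hc] concerns the [y] with [a (c * y)], the required multiplier is the inverse of [c]. *)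
have [[u v] /= uv] := coprimeP _ c0 cc.
have uE : u * c = 1 + v * P by move: uv; clear; lia.
have P1 : 1 < P := prime_gt1 pp.
have uc : (u %% P) * c = 1 %[mod P] by rewrite modnMml uE addnC modnMDl.
exists (u %% P); split.
  have := ltn_pmod u P0; rewrite lt0n.
  have : u %% P != 0 by apply/eqP=> u0; move: uc; rewrite u0 mul0n mod0n modn_small.
  by move: (u %% P) => w; clear; lia.
move=> x xA; have yP : (u %% P * x) %% P < P by rewrite ltn_mod.
have [|h1 h2] := hc _ yP.
  rewrite /a -modnMmr modn_mod modnMmr mulnA -modnMml (mulnC c) uc modnMml mul1n.
  by rewrite -/(a x) aE.
by rewrite h1 /=; move: h2; move: (u %% P * x %% P) #|A| => w n; clear; lia.
Qed.
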